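(* Let $\mathscr{M}$ be an $n$-dimensional smooth manifold and let $X(\cdot,t):\mathscr{M}\to\mathbb{R}^{n+1}$ be a smooth one-parameter family of hypersurface immersions solving the hyperbolic mean curvature flow $\frac{\partial^2X}{\partial t^2}=H\vec n$. Then, in any local coordinates $\{x^i\}$ on $\mathscr{M}$, $$\begin{aligned}\frac{\partial^2H}{\partial t^2}&=\bigtriangleup H+H|A|^2-2g^{ik}g^{jl}h_{ij}\Big(\frac{\partial^2X}{\partial t\partial x^k},\frac{\partial^2X}{\partial t\partial x^l}\Big)+Hg^{kl}\Big(\vec n,\frac{\partial^2X}{\partial t\partial x^k}\Big)\Big(\vec n,\frac{\partial^2X}{\partial t\partial x^l}\Big)\\&\quad-2g^{ij}\frac{\partial\Gamma^k_{ij}}{\partial t}\Big(\vec n,\frac{\partial^2X}{\partial t\partial x^k}\Big)+2g^{ik}g^{jp}g^{lq}h_{ij}\frac{\partial g_{pq}}{\partial t}\frac{\partial g_{kl}}{\partial t}-2g^{ik}g^{jl}\frac{\partial g_{kl}}{\partial t}\frac{\partial h_{ij}}{\partial t},\end{aligned}$$ and $$\begin{aligned}\frac{\partial^2}{\partial t^2}|A|^2&=\bigtriangleup(|A|^2)-2|\nabla A|^2+2|A|^4+2|A|^2g^{pq}\Big(\vec n,\frac{\partial^2X}{\partial t\partial x^p}\Big)\Big(\vec n,\frac{\partial^2X}{\partial t\partial x^q}\Big)\\&\quad+2g^{ij}g^{kl}\frac{\partial h_{ik}}{\partial t}\frac{\partial h_{jl}}{\partial t}-8g^{im}g^{jn}g^{kl}h_{jl}\frac{\partial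 g_{mn}}{\partial t}\frac{\partial h_{ik}}{\partial t}-4g^{im}g^{jn}g^{kl}h_{ik}h_{jl}\Big(\frac{\partial^2X}{\partial t\partial x^m},\frac{\partial^2X}{\partial t\partial x^n}\Big)\\&\quad+2g^{im}\frac{\partial g_{pq}}{\partial t}\frac{\partial g_{mn}}{\partial t}h_{ik}h_{jl}\Big(2g^{jp}g^{nq}g^{kl}+g^{jn}g^{kp}g^{lq}\Big)-4g^{ij}g^{kl}h_{jl}\frac{\partial\Gamma^p_{ik}}{\partial t}\Big(\vec n,\frac{\partial^2X}{\partial t\partial x^p}\Big).\end{aligned}$$
   Context: Repeated indices are summed from $1$ to the dimension of $\mathscr{M}$ (the letter $n$ used as an index in the second formula is a summation index), and $(\cdot,\cdot)$ is the Euclidean inner product on $\mathbb{R}^{n+1}$. For each $t$: - $\vec n(x,t)$ is the unit inner normal vector of $X(\cdot,t)$. - $g_{ij}=\big(\frac{\partial X}{\partial x^i},\frac{\partial X}{\partial x^j}\big)$ is the induced metric, $g^{ij}$ its inverse, and $\Gamma^k_{ij}$ its Christoffel symbols. - $A=\{h_{ij}\}$ is the second fundamental form, with sign fixed by the Gauss–Weingarten relations $\frac{\partial^2X}{\partial x^i\partial x^j}=\Gamma^k_{ij}\frac{\partial X}{\partial x^k}+h_{ij}\vec n$ and $\frac{\partial\vec n}{\partial x^j}=-h_{jl}g^{lm}\frac{\partial X}{\partial x^m}$. - $H=g^{ij}h_{ij}$ is the mean curvature, and $|A|^2=g^{ij}g^{kl}h_{ik}h_{jl}$. - $\nabla$ is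 the Levi-Civita connection of $g(t)$, $\bigtriangleup=g^{ij}\nabla_i\nabla_j$ is its Laplacian, $\nabla A$ is the covariant derivative of the second fundamental form, and $|\nabla A|^2$ is its squared norm with respect to $g(t)$. *)

(* Defs.v *)
From mathcomp Require Import all_boot all_order all_algebra.
From mathcomp Require Import all_classical all_reals all_analysis.

Set Implicit Arguments.
Unset Strict Implicit.
Unset Printing Implicit Defensive.

Import Order.TTheory GRing.Theory Num.Theory.
Import numFieldNormedType.Exports.

Local Open Scope classical_set_scope.
Local Open Scope ring_scope.

Section SmoothMaps.
Variables (R : realType) (V W : normedModType R).

(* Meant for open [U] and finite-dimensional [V]; there, the differential is of
   class C^k iff all its evaluations ['D_v f] at fixed vectors are. *)
Fixpoint class_C (k : nat) (U : set V) (f : V -> W) : Prop :=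
  match k with
  | 0 => forall x, U x -> {for x, continuous f}
  | k'.+1 => (forall x, U x -> differentiable f x) /\
             (forall v, class_C k' U ('D_v f))
  end.

Definition smooth_on (U : set V) (f : V -> W) : Prop :=
  forall k, class_C k U f.

End SmoothMaps.

(* Only the restrictions of [chart_map] to [chart_dom] and of [chart_inv] to
   [chart_cod] are meaningful. *)
Record chart (R : realType) (n : nat) (M : topologicalType) := Chart {
  chart_dom : set M;
  chart_cod : set 'rV[R]_n;
  chart_map : M -> 'rV[R]_n;
  chart_inv : 'rV[R]_n -> M;
  chart_dom_open : open chart_dom;
  chart_cod_open : open chart_cod;
  chart_mapP : forall p, chart_dom p -> chart_cod (chart_map p);
  chart_invP : forall x, chart_cod x -> chart_dom (chart_inv x);
  chart_mapK : forall p, chart_dom p -> chart_inv (chart_map p) = p;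
  chart_invK : forall x, chart_cod x -> chart_map (chart_inv x) = x;
  chart_map_continuous : forall p, chart_dom p -> {for p, continuous chart_map};
  chart_inv_continuous : forall x, chart_cod x -> {for x, continuous chart_inv}
}.

Section Manifolds.
Variables (R : realType) (n : nat).

Definition smooth_transition (M : topologicalType) (c c' : chart R n M) :=
  smooth_on [set x | chart_cod c x /\ chart_dom c' (chart_inv c x)]
            (chart_map c' \o chart_inv c).

Definition compatible_charts (M : topologicalType) (c c' : chart R n M) :=
  smooth_transition c c' /\ smooth_transition c' c.

(* The smooth structure is a maximal atlas, so that "any local coordinates" are
   exactly the members of [atlas]. *)
Record smooth_manifold := SmoothManifold {
  carrier :> topologicalType;
  atlas : set (chart R n carrier);
  manifold_hausdorff : hausdorff_space carrier;
  manifold_second_countable : @second_countable carrier;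
  atlas_cover : forall p : carrier, exists2 c, atlas c & chart_dom c p;
  atlas_compatible :
    forall c c', atlas c -> atlas c' -> compatible_charts c c';
  atlas_maximal :
    forall c, (forall c', atlas c' -> compatible_charts c c') -> atlas c
}.

Definition in_chart (M : smooth_manifold) (W : Type) (F : R -> M -> W)
  (c : chart R n M) : R -> 'rV[R]_n -> W := fun t x => F t (chart_inv c x).

Definition smooth_family (M : smooth_manifold) (W : normedModType R)
    (I : set R) (F : R -> M -> W) : Prop :=
  forall c, atlas c ->
    smooth_on (I `*` chart_cod c)
              (fun p : R * 'rV[R]_n => in_chart F c p.1 p.2).

End Manifolds.

Section LocalGeometry.
Variables (R : realType) (n : nat).

Definition inner (m : nat) (v w : 'rV[R]_m) : R := \sum_i v 0 i * w 0 i.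

Definition dt (W : normedModType R) (f : R -> 'rV[R]_n -> W) :
  R -> 'rV[R]_n -> W := fun t x => derive1 (f^~ x) t.

Definition dx (W : normedModType R) (i : 'I_n) (f : R -> 'rV[R]_n -> W) :
  R -> 'rV[R]_n -> W := fun t x => 'D_(delta_mx 0 i) (f t) x.

(* [X] and [nu] are the immersion and its unit normal read in a chart. *)
Variables X nu : R -> 'rV[R]_n -> 'rV[R]_n.+1.

Definition g_ (i j : 'I_n) : R -> 'rV[R]_n -> R :=
  fun t x => inner (dx i X t x) (dx j X t x).

Definition ginv (i j : 'I_n) : R -> 'rV[R]_n -> R :=
  fun t x => invmx (\matrix_(k, l) g_ k l t x) i j.

(* [Gamma k i j] is $\Gamma^k_{ij}$. *)
Definition Gamma (k i j : 'I_n) : R -> 'rV[R]_n -> R :=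
  fun t x => 2^-1 * \sum_l ginv k l t x *
    (dx i (g_ j l) t x + dx j (g_ i l) t x - dx l (g_ i j) t x).

(* The normal component in the Gauss relation
   X_ij = Gamma^k_ij X_k + h_ij nu, where nu is a unit normal. *)
Definition h_ (i j : 'I_n) : R -> 'rV[R]_n -> R :=
  fun t x => inner (dx i (dx j X) t x) (nu t x).

Definition meanH : R -> 'rV[R]_n -> R :=
  fun t x => \sum_i \sum_j ginv i j t x * h_ i j t x.

Definition normA2 : R -> 'rV[R]_n -> R :=
  fun t x => \sum_i \sum_j \sum_k \sum_l
    ginv i j t x * ginv k l t x * h_ i k t x * h_ j l t x.

(* $(\nabla_k w)_i$ for a covector field and $(\nabla_k T)_{ij}$ for a
   covariant 2-tensor field. *)
Definition nabla1 (w : 'I_n -> R -> 'rV[R]_n -> R) (k i : 'I_n) :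
    R -> 'rV[R]_n -> R :=
  fun t x => dx k (w i) t x - \sum_l Gamma l k i t x * w l t x.

Definition nabla2 (T : 'I_n -> 'I_n -> R -> 'rV[R]_n -> R) (k i j : 'I_n) :
    R -> 'rV[R]_n -> R :=
  fun t x => dx k (T i j) t x - \sum_l Gamma l k i t x * T l j t x
                              - \sum_l Gamma l k j t x * T i l t x.

Definition laplacian (f : R -> 'rV[R]_n -> R) : R -> 'rV[R]_n -> R :=
  fun t x => \sum_i \sum_j
    ginv i j t x * nabla1 (fun l => dx l f) i j t x.

Definition norm_nablaA2 : R -> 'rV[R]_n -> R :=
  fun t x => \sum_k \sum_r \sum_i \sum_p \sum_j \sum_q
    ginv k r t x * ginv i p t x * ginv j q t x *
    nabla2 h_ k i j t x * nabla2 h_ r p q t x.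

End LocalGeometry.

Section HyperbolicMeanCurvatureFlow.
Variables (R : realType) (n : nat) (M : smooth_manifold R n) (I : set R).
Variables X N : R -> M -> 'rV[R]_n.+1.

Definition immersion_family : Prop :=
  smooth_family I X /\
  forall c, atlas c -> forall t x, I t -> chart_cod c x ->
    injective ('d (in_chart X c t) x).

(* For a general immersion "inner" only amounts to a choice of sign of the
   normal, which [N] records; $H\vec n$ does not depend on it. *)
Definition unit_normal_family : Prop :=
  [/\ smooth_family I N,
      (forall t p, I t -> inner (N t p) (N t p) = 1)
    & forall c, atlas c -> forall t x, I t -> chart_cod c x ->
      forall i : 'I_n, inner (in_chart N c t x) (dx i (in_chart X c) t x) = 0].

(* $H$ being invariant under changes of coordinates, the flow equation on [M]
   is stated by computing $H$ in charts. *)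
Definition hyperbolic_mcf : Prop :=
  forall c, atlas c -> forall t x, I t -> chart_cod c x ->
    dt (dt (in_chart X c)) t x =
      meanH (in_chart X c) (in_chart N c) t x *: in_chart N c t x.

End HyperbolicMeanCurvatureFlow.

(* Main.v *)
Require Import Defs.
From HB Require Import structures.
From mathcomp Require Import all_boot all_order all_algebra.
From mathcomp Require Import all_classical all_reals all_analysis.
From mathcomp Require Import ring lra.

Set Implicit Arguments.
Unset Strict Implicit.
Unset Printing Implicit Defensive.

Import Order.TTheory GRing.Theory Num.Theory.
Import numFieldNormedType.Exports.

Local Open Scope classical_set_scope.
Local Open Scope ring_scope.

(** In a fixed chart both identities are polynomial identities between
    functions of time and space, and their proof only uses the rules of
    calculus: derivatives are additive, satisfy the Leibniz rule and commute.
    So the geometry is done over an arbitrary commutative ring K with commuting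
    derivations D i (the coordinate fields) and T (time), and is applied to the
    ring of smooth functions on (times) x (chart domain), where equality of
    functions is equality of ring elements and no differentiability side
    condition remains.

    Over K, let J be the matrix whose rows are the tangent vectors
    X_i = D i X, let nu be the normal, g = J J^T, and G the inverse of g. As
    (J, nu) is a square matrix, its one-sided inverse is two-sided:
    J^T G J + nu^T nu = 1 ([frame_complete]), which splits every vector into
    its tangential and normal parts. The Gauss formula and the Weingarten
    formula (for any derivation, T included) are this splitting for the
    derivatives of J and nu; the Codazzi and Gauss equations and the Ricci
    identity come from comparing D i D k with D k D i. Tensors are matrices: for symmetric S,
    |S|^2 is the trace of S G S G, and the covariant derivative satisfies
    D_k (S G) = (nabla_k S) G + [Gamma_k, S G], so that Christoffel symbols
    disappear from traces. Commuting two covariant derivatives of h gives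
      Delta h = Hess H + H h G h - |A|^2 h            ([laplacian_sff]),
    hence Simons' formula for Delta |A|^2             ([simons_identity]).

    On the time side the flow X_tt = H nu gives
      g_tt = - 2 H h + 2 (X_tk, X_tl)                 ([metric_acceleration]),
      h_tt = Hess H - H h G h + |nu_t|^2 h - 2 Z      ([sff_acceleration]),
    where |nu_t|^2 = g^kl (nu, X_tk) (nu, X_tl), and Z_ik is the contraction of
    the time derivative of Gamma^p_ik with (nu, X_tp). Differentiating
    H = tr (h G) and |A|^2 = tr (h G h G) twice, with G_tt computed from
    G g = 1, and eliminating the trace of Hess H G h G by Simons' formula,
    yields the two equations as identities between traces. What is left is to
    write these traces as the index sums of the theorem.

    The analytic input is that smooth functions form such a ring (closure of
    class C^k under products and inverses, [derive_comm] for the symmetry of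
    second derivatives) and that g is invertible in it, its determinant having
    no zero because X is an immersion ([gram_unit]). *)

(** * Matrices over a ring with derivations *)

Section Leibniz.
Variable K : comPzRingType.

Definition leibniz (d : K -> K) := forall x y, d (x * y) = d x * y + x * d y.

Variables (d : {additive K -> K}) (d_leibniz : leibniz d).

Lemma leibniz1 : d 1 = 0.
Proof.
have := d_leibniz 1 1; rewrite !mulr1 mul1r => /eqP.
by rewrite -subr_eq subrr eq_sym => /eqP.
Qed.

Lemma map_mx_leibniz m n p (A : 'M[K]_(m, n)) (B : 'M[K]_(n, p)) :
  map_mx d (A *m B) = map_mx d A *m B + A *m map_mx d B.
Proof.
apply/matrixP => i j; rewrite !mxE raddf_sum -big_split /=.
by apply: eq_bigr => k _; rewrite d_leibniz !mxE.
Qed.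

Lemma map_mx_leibniz1 n : map_mx d (1%:M : 'M[K]_n) = 0.
Proof. by apply/matrixP => i j; rewrite !mxE raddfMn leibniz1 mul0rn. Qed.

Lemma map_mx_leibniz_inv n (A B : 'M[K]_n) : B *m A = 1%:M ->
  map_mx d B = - (B *m map_mx d A *m B).
Proof.
move=> BA; have AB := mulmx1C BA.
have := map_mx_leibniz B A; rewrite BA map_mx_leibniz1 => /esym/eqP.
rewrite addr_eq0 => /eqP/(congr1 (mulmx^~ B)).
by rewrite -mulmxA AB mulmx1 mulNmx.
Qed.

Lemma additive_mxtrace n (A : 'M[K]_n) : d (\tr A) = \tr (map_mx d A).
Proof. by rewrite /mxtrace raddf_sum; apply: eq_bigr => i _; rewrite mxE. Qed.

End Leibniz.

(** Unlike [mxE], these leave matrix products folded, so that an identity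
    between sums of products becomes a [ring] goal whose atoms are entries of
    products. *)
Lemma entryD (V : nmodType) m n (A B : 'M[V]_(m, n)) i j :
  (A + B) i j = A i j + B i j.
Proof. by rewrite mxE. Qed.
Lemma entryN (V : zmodType) m n (A : 'M[V]_(m, n)) i j : (- A) i j = - A i j.
Proof. by rewrite mxE. Qed.
Lemma entryZ (K : pzRingType) m n x (A : 'M[K]_(m, n)) i j :
  (x *: A) i j = x * A i j.
Proof. by rewrite mxE. Qed.
Definition entryE := (entryD, entryN, entryZ).

Definition mxdistr := (mulmxDl, mulmxDr, mulmxBl, mulmxBr, mulmxN, mulNmx).

Lemma mxtraceN (V : pzRingType) n (A : 'M[V]_n) : \tr (- A) = - \tr A.
Proof. exact: raddfN. Qed.
Definition mxtraceE := (mxtraceD, mxtraceN, mxtraceZ).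

Lemma trmxD (V : nmodType) m n (A B : 'M[V]_(m, n)) : (A + B)^T = A^T + B^T.
Proof. exact: raddfD. Qed.
Lemma trmxN (V : zmodType) m n (A : 'M[V]_(m, n)) : (- A)^T = - A^T.
Proof. exact: raddfN. Qed.
Definition trmxE := (trmxD, trmxN, @trmx_mul, @trmxK).

Lemma mulmx_col_row (K : pzSemiRingType) m n (u : 'cV[K]_m) (v : 'rV_n) i j :
  (u *m v) i j = u i 0 * v 0 j.
Proof. by rewrite mxE big_ord1. Qed.

(** * The moving frame of a hypersurface *)

(** Here K stands for a ring of functions and the D i for its coordinate
    derivatives. Row i of J is the i-th tangent vector, and G is the inverse of
    the metric J J^T. Absence of 2-torsion serves to deduce (d nu, nu) = 0 from
    2 (d nu, nu) = d (nu, nu) = 0. *)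
Section MovingFrame.
Variables (K : comPzRingType) (n m : nat).
Variables (D : 'I_n -> {additive K -> K}).
Hypothesis D_leibniz : forall i, leibniz (D i).
Hypothesis D_comm : forall i j x, D i (D j x) = D j (D i x).
Hypothesis no_2torsion : forall x : K, x + x = 0 -> x = 0.
Hypothesis m_eq : m = (n + 1)%N.
Variables (X nu : 'rV[K]_m) (G : 'M[K]_n).

Definition tangent (Y : 'rV[K]_m) : 'M[K]_(n, m) :=
  \matrix_(i, a) D i (Y 0 a).
Let J := tangent X.

Hypothesis G_sym : G^T = G.
Hypothesis G_inv : G *m (J *m J^T) = 1%:M.
Hypothesis nu_unit : nu *m nu^T = 1%:M.
Hypothesis nu_normal : J *m nu^T = 0.

Let nu_normal' : nu *m J^T = 0.
Proof. by rewrite -[LHS]trmxK trmx_mul trmxK nu_normal trmx0. Qed.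

(** The matrices (G J ; nu) and (J^T, nu^T) are square because there is exactly
    one normal direction, and their product in one order is 1. *)
Lemma frame_complete : J^T *m G *m J + nu^T *m nu = 1%:M.
Proof.
have H : (col_mx (G *m J) nu : 'M[K]_(n + 1, m)) *m row_mx J^T nu^T = 1%:M.
  rewrite mul_col_row -!mulmxA nu_normal nu_normal' nu_unit G_inv mulmx0.
  by rewrite -scalar_mx_block.
suff : row_mx J^T nu^T *m (col_mx (G *m J) nu : 'M[K]_(n + 1, m)) = 1%:M.
  by rewrite mul_row_col mulmxA.
move: H; move: (col_mx _ _) (row_mx _ _); move: (esym m_eq); clear.
by case: m / => A B; apply: mulmx1C.
Qed.

(** Row i of [christoffel k] contains the Gamma^l_ki, the coefficients in the
    X_l of the tangential part of D_k X_i; this makes it the connection matrix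
    of the k-th direction. *)
Definition christoffel k : 'M[K]_n := map_mx (D k) J *m J^T *m G.
Definition sff_col k : 'cV[K]_n := map_mx (D k) J *m nu^T.
Definition sff : 'M[K]_n := \matrix_(k, i) sff_col k i 0.

Local Notation Gam := christoffel.
Local Notation h := sff.

(** Equality of mixed partial derivatives of X, the source of the symmetry of
    both Gamma^l_ki and h_ki. *)
Lemma DJ_sym k i a : map_mx (D k) J i a = map_mx (D i) J k a.
Proof. by rewrite !mxE D_comm. Qed.

Lemma DJM_sym p k i (M : 'M[K]_(m, p)) a :
  (map_mx (D k) J *m M) i a = (map_mx (D i) J *m M) k a.
Proof. by rewrite !mxE; apply: eq_bigr => b _; rewrite DJ_sym. Qed.

Lemma christoffel_sym k i l : Gam k i l = Gam i k l.
Proof. by rewrite /christoffel -!mulmxA DJM_sym. Qed.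

(** With B_abq = (D_a X_b, X_q), symmetric in a and b, one has
    D_a g_bq = B_abq + B_aqb, and the alternating sum of three such terms leaves
    2 B_kiq. This identifies [christoffel] with the usual expression of the
    Christoffel symbols in terms of the metric. *)
Lemma christoffel_koszul k i l : christoffel k i l *+ 2 =
  \sum_q G l q * (D k ((J *m J^T) i q) + D i ((J *m J^T) k q)
                  - D q ((J *m J^T) k i)).
Proof.
pose B k' := map_mx (D k') J *m J^T.
have Bs a b q : B a b q = B b a q by exact: DJM_sym.
have DgE a b q : D a ((J *m J^T) b q) = B a b q + B a q b.
  have : map_mx (D a) (J *m J^T) b q = D a ((J *m J^T) b q) by rewrite mxE.
  move=> <-; rewrite map_mx_leibniz // entryD -/(B a); congr (_ + _).
  rewrite -map_trmx -[J in J *m _]trmxK -trmx_mul mxE.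
  by [].
rewrite mxE -sumrMnl; apply: eq_bigr => q _; rewrite -/(B k) !DgE.
have GE : G q l = G l q by rewrite -[in LHS]G_sym mxE.
by rewrite GE (Bs i k) (Bs q k) (Bs q i); ring.
Qed.

Lemma sffE k i : h k i = sff_col k i 0.
Proof. by rewrite mxE. Qed.

Lemma sff_sym : h^T = h.
Proof. by apply/matrixP => i k; rewrite mxE !sffE; exact: DJM_sym. Qed.

Lemma sff_colE k : sff_col k = col k h.
Proof. by apply/colP => i; rewrite -sffE -[in LHS]sff_sym !mxE. Qed.

Lemma gauss_formula k : map_mx (D k) J = Gam k *m J + sff_col k *m nu.
Proof. by rewrite -!mulmxA -mulmxDr !mulmxA frame_complete mulmx1. Qed.

Lemma normal_derivation_normal (d : {additive K -> K}) : leibniz d ->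
  map_mx d nu *m nu^T = 0.
Proof.
move=> dL; have := map_mx_leibniz dL nu nu^T.
rewrite nu_unit map_mx_leibniz1 // -map_trmx.
have <- : (map_mx d nu *m nu^T)^T = nu *m (map_mx d nu)^T.
  by rewrite trmx_mul trmxK.
move/matrixP => e; apply/matrixP => i j; rewrite [RHS]mxE.
apply: no_2torsion; have := e i j; rewrite entryD (ord1 i) (ord1 j).
by rewrite [X in X = _]mxE [X in _ = _ + X]mxE => <-.
Qed.

(** The normal component vanishes since nu has constant length, and the
    tangential one comes from differentiating J nu^T = 0. Stated for every
    derivation, as it is used both in space and in time. *)
Lemma weingarten_formula (d : {additive K -> K}) : leibniz d ->
  map_mx d nu = - ((map_mx d J *m nu^T)^T *m G *m J).
Proof.
move=> dL; rewrite -[LHS]mulmx1 -frame_complete mulmxDr !mulmxA.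
rewrite normal_derivation_normal // mul0mx addr0 -!mulNmx; congr (_ *m _ *m _).
have := map_mx_leibniz dL J nu^T; rewrite nu_normal map_mx0 -map_trmx.
move/esym/eqP; rewrite addr_eq0 => /eqP -> .
by rewrite trmxN opprK trmx_mul trmxK.
Qed.

(** The compatibility of the connection with the metric, written for the
    inverse metric. *)
Lemma derivation_ginv k :
  map_mx (D k) G = - (G *m Gam k) - (Gam k)^T *m G.
Proof.
have JJG := mulmx1C G_inv.
rewrite (map_mx_leibniz_inv (D_leibniz k) G_inv) map_mx_leibniz //.
rewrite mulmxDr mulmxDl opprD /christoffel; congr (_ - _); last first.
  by rewrite !trmx_mul trmxK G_sym -map_trmx !mulmxA.
by rewrite !mulmxA.
Qed.

Definition nabla k (S : 'M[K]_n) : 'M[K]_n := \matrix_(i, j)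
  (D k (S i j) - \sum_l Gam k i l * S l j - \sum_l Gam k j l * S i l).

Lemma nablaE k S :
  nabla k S = map_mx (D k) S - Gam k *m S - S *m (Gam k)^T.
Proof.
apply/matrixP => i j; rewrite mxE !entryE; congr (_ - _ - _).
- by rewrite mxE.
- by rewrite mxE.
- by rewrite mxE; apply: eq_bigr => l _; rewrite [_^T _ _]mxE mulrC.
Qed.

Lemma nabla_tr k S : (nabla k S)^T = nabla k S^T.
Proof.
rewrite !nablaE; move: (Gam k) => C.
by rewrite !trmxE map_trmx addrAC.
Qed.

(** S G is an endomorphism field, on which the connection acts by a commutator.
    Commutators have trace 0: this is why the two lemmas that follow
    differentiate traces as if the Christoffel symbols vanished. *)
Lemma derivation_mulG k S : map_mx (D k) (S *m G) =
  nabla k S *m G + (Gam k *m (S *m G) - (S *m G) *m Gam k).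
Proof.
rewrite map_mx_leibniz // derivation_ginv nablaE; move: (Gam k) => C.
rewrite !mxdistr !mulmxA.
by apply/matrixP => i j; rewrite !entryE; ring.
Qed.

Lemma derivation_tr1 k S : D k (\tr (S *m G)) = \tr (nabla k S *m G).
Proof.
rewrite additive_mxtrace derivation_mulG !mxtraceE.
by rewrite [X in _ - X]mxtrace_mulC subrr addr0.
Qed.

Lemma derivation_tr2 k S T : D k (\tr (S *m G *m (T *m G))) =
  \tr (nabla k S *m G *m (T *m G)) + \tr (S *m G *m (nabla k T *m G)).
Proof.
rewrite additive_mxtrace map_mx_leibniz // !derivation_mulG.
move: (nabla k S) (nabla k T) (Gam k) (S *m G) (T *m G) => S' T' C A B.
have cyc : \tr (C *m A *m B) = \tr (A *m B *m C).
  by rewrite -mulmxA mxtrace_mulC.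
by rewrite !mxdistr !mulmxA !mxtraceE cyc; ring.
Qed.

(** Normal component of D_a D_b J: it equals D_a h_b + Gamma_b h_a, which is
    therefore symmetric in a and b. *)
Lemma codazzi k i j : nabla k h i j = nabla i h k j.
Proof.
have H a b : map_mx (D a) (sff_col b) + Gam b *m sff_col a =
             map_mx (D a) (map_mx (D b) J) *m nu^T.
  rewrite /sff_col map_mx_leibniz // -map_trmx weingarten_formula //.
  rewrite !trmxE G_sym mulmxN !mulmxA.
  by rewrite subrK.
have E : map_mx (D k) (map_mx (D i) J) = map_mx (D i) (map_mx (D k) J).
  by apply/matrixP => a b; rewrite !mxE D_comm.
have := H k i; rewrite E -H => /matrixP/(_ j 0).
have F a b : map_mx (D a) h b j = map_mx (D a) (sff_col b) j 0.
  by rewrite !mxE.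
have Sj a b : (Gam a *m sff_col b) j 0 = (h *m (Gam a)^T) b j.
  have -> : (h *m (Gam a)^T) b j = (h *m (Gam a)^T)^T j b by rewrite [RHS]mxE.
  rewrite !trmxE sff_sym sff_colE [LHS]mxE [RHS]mxE.
  by apply: eq_bigr => l _; rewrite [col _ _ _ _]mxE.
have Sk : (Gam k *m h) i j = (Gam i *m h) k j.
  by rewrite !mxE; apply: eq_bigr => l _; rewrite christoffel_sym.
rewrite !entryD !Sj -!F => e.
rewrite !nablaE !entryE Sk.
have -> : map_mx (D k) h i j =
    map_mx (D i) h k j + (h *m (Gam k)^T) i j - (h *m (Gam i)^T) k j.
  by rewrite -e; ring.
by ring.
Qed.

(** Curvature of the connection, as the endomorphism matrix attached to the
    directions i and k; the sign is the one for which the Ricci identity reads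
    as below. *)
Definition curvature i k :=
  map_mx (D i) (Gam k) - map_mx (D k) (Gam i) - Gam i *m Gam k + Gam k *m Gam i.

(** Tangential component of D_a D_b J: it equals
    D_a Gamma_b + Gamma_b Gamma_a - h_b h_a^T G, which is therefore symmetric in
    a and b. *)
Lemma gauss_equation i k : curvature i k =
  (sff_col k *m (sff_col i)^T - sff_col i *m (sff_col k)^T) *m G.
Proof.
have H a b : map_mx (D a) (Gam b) + Gam b *m Gam a =
  map_mx (D a) (map_mx (D b) J) *m J^T *m G + sff_col b *m (sff_col a)^T *m G.
  rewrite /christoffel !map_mx_leibniz // derivation_ginv mulmxBr mulmxN.
  rewrite -!/(Gam _) mulmxDl.
  have -> : map_mx (D b) J *m map_mx (D a) J^T *m G =
    map_mx (D b) J *m J^T *m ((Gam a)^T *m G) + sff_col b *m (sff_col a)^T *m G.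
    rewrite -map_trmx [in LHS](gauss_formula a) trmxD mulmxDr mulmxDl.
    by rewrite !trmx_mul !mulmxA.
  have -> : map_mx (D b) J *m J^T *m (G *m Gam a) = Gam b *m Gam a.
    by rewrite !mulmxA.
  rewrite -!/(Gam _).
  by apply/matrixP => x y; rewrite !entryE; ring.
have E : map_mx (D i) (map_mx (D k) J) = map_mx (D k) (map_mx (D i) J).
  by apply/matrixP => a b; rewrite !mxE D_comm.
have -> : curvature i k = (map_mx (D i) (Gam k) + Gam k *m Gam i) -
                          (map_mx (D k) (Gam i) + Gam i *m Gam k).
  by apply/matrixP => x y; rewrite /curvature !entryE; ring.
by rewrite !H E mulmxBl opprD addrACA subrr add0r.
Qed.

Lemma ricci_identity i k S : nabla i (nabla k S) - nabla k (nabla i S) =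
  - (curvature i k *m S) - S *m (curvature i k)^T.
Proof.
have E : map_mx (D i) (map_mx (D k) S) = map_mx (D k) (map_mx (D i) S).
  by apply/matrixP => a b; rewrite !mxE D_comm.
rewrite !nablaE /curvature; move: (Gam i) (Gam k) => A B.
rewrite !(map_mxB, map_mxD) !map_mx_leibniz // E.
rewrite !trmxE -!map_trmx !mxdistr !mulmxA.
by apply/matrixP => x y; rewrite !entryE; ring.
Qed.

(** * Hessians and Simons' formula *)

Definition hessian f : 'M[K]_n :=
  \matrix_(i, j) (D i (D j f) - \sum_l Gam i j l * D l f).

Definition laplace f := \sum_i \sum_j G i j * hessian f i j.

(** In [nabla i (nabla j S)] the index j is a mere label; the subtracted sum
    makes it a tensor index. *)
Definition second_nabla i j S :=
  nabla i (nabla j S) - \sum_l Gam i j l *: nabla l S.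

Lemma hessian_tr1 S i j :
  hessian (\tr (S *m G)) i j = \tr (second_nabla i j S *m G).
Proof.
rewrite mxE !derivation_tr1 /second_nabla.
rewrite [in RHS]mulmxBl [RHS]mxtraceD mxtraceN.
congr (_ - _); rewrite mulmx_suml raddf_sum /=; apply: eq_bigr => l _.
by rewrite derivation_tr1 -scalemxAl mxtraceZ.
Qed.

Lemma hessian_tr2 S i j : hessian (\tr (S *m G *m (S *m G))) i j =
  (\tr (second_nabla i j S *m G *m (S *m G)) +
   \tr (nabla j S *m G *m (nabla i S *m G))) *+ 2.
Proof.
have E k : D k (\tr (S *m G *m (S *m G))) =
           \tr (nabla k S *m G *m (S *m G)) *+ 2.
  by rewrite derivation_tr2 mulr2n; congr (_ + _); rewrite mxtrace_mulC.
rewrite mxE !E raddfMn derivation_tr2 /second_nabla.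
move: (nabla j S) (nabla i S) (nabla i (nabla j S)) => Sj Si S2.
rewrite !mulmxBl mxtraceD mxtraceN [in RHS]addrAC [RHS]mulrnBl.
congr (_ - _); rewrite !mulmx_suml raddf_sum -sumrMnl /=.
apply: eq_bigr => l _.
by rewrite E -!scalemxAl mxtraceZ mulrnAr.
Qed.

Lemma second_nabla_sff_sym i j k l :
  second_nabla i j h k l = second_nabla i j h l k.
Proof.
have S a : (nabla a h)^T = nabla a h by rewrite nabla_tr sff_sym.
have : (second_nabla i j h)^T = second_nabla i j h.
  rewrite /second_nabla trmxD trmxN nabla_tr S; congr (_ - _).
  rewrite raddf_sum /=; apply: eq_bigr => p _.
  by rewrite -[in RHS]S; apply/matrixP => a b; rewrite !mxE.
by move=> e; rewrite -[in LHS]e mxE.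
Qed.

(** The symmetry of nabla h in its three indices survives a further covariant
    derivative. *)
Lemma codazzi2 i j k l : second_nabla i j h k l = second_nabla i k h j l.
Proof.
pose C a b c := nabla a h b c.
have C12 a b c : C a b c = C b a c by apply: codazzi.
have nE a b c d : nabla a (nabla b h) c d = D a (C b c d)
    - \sum_p Gam a c p * C b p d - \sum_p Gam a d p * C b c p.
  by rewrite [in LHS]mxE.
have sE a b c d : (\sum_p Gam a b p *: nabla p h) c d =
                  \sum_p Gam a b p * C p c d.
  by rewrite summxE; apply: eq_bigr => p _; rewrite entryZ.
rewrite /second_nabla !entryE !sE !nE (C12 k j).
under [X in _ = _ - X - _ - _]eq_bigr do rewrite C12.
under [X in _ = _ - X]eq_bigr do rewrite C12.
under [X in _ = _ - _ - X - _]eq_bigr do rewrite (C12 k).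
ring.
Qed.

Definition mean_curvature := \tr (h *m G).
Definition sff_norm2 := \tr (h *m G *m (h *m G)).
Local Notation H := mean_curvature.
(* W is the square of the second fundamental form, h_ip g^pq h_qj. *)
Local Notation W := (h *m G *m h).

(** Ricci identity for h, with the curvature replaced by its value in the Gauss
    equation. The Christoffel terms of [second_nabla] cancel by symmetry. *)
Lemma ricci_sff i k j l : second_nabla i k h j l - second_nabla k i h j l =
  h i j * W k l - h k j * W i l + (h i l * W k j - h k l * W i j).
Proof.
have P a b c d :
    (sff_col a *m (sff_col b)^T *m G *m h) c d = h a c * W b d.
  rewrite !sff_colE -!mulmxA mulmx_col_row tr_col sff_sym -row_mul.
  congr (_ * _); last by rewrite [LHS]mxE.
  by rewrite -[in LHS]sff_sym [LHS]mxE [LHS]mxE.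
have OE a b : (curvature i k *m h) a b = h k a * W i b - h i a * W k b.
  by rewrite gauss_equation !mulmxBl entryD entryN !P.
have -> : second_nabla i k h j l - second_nabla k i h j l =
    (nabla i (nabla k h) - nabla k (nabla i h)) j l.
  have e : \sum_l Gam k i l *: nabla l h = \sum_l Gam i k l *: nabla l h.
    by apply: eq_bigr => p _; rewrite christoffel_sym.
  by rewrite /second_nabla e !entryE; ring.
have HT : h *m (curvature i k)^T = (curvature i k *m h)^T.
  by rewrite trmx_mul sff_sym.
have sE a b : h a b = h b a by rewrite -[in LHS]sff_sym mxE.
rewrite ricci_identity entryD !entryN HT [_^T _ _]mxE !OE.
by rewrite (sE k j) (sE i j) (sE k l) (sE i l); ring.
Qed.

Lemma ginvE i j : G i j = G j i.
Proof. by rewrite -[in LHS]G_sym mxE. Qed.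

Lemma contract_ginv (S : 'M[K]_n) : \sum_i \sum_j G i j * S i j = \tr (S *m G).
Proof.
apply: eq_bigr => i _; rewrite mxE; apply: eq_bigr => j _.
by rewrite mulrC ginvE.
Qed.

Lemma contract_ginv2 (A B : 'M[K]_n) k l :
  \sum_i \sum_j G i j * A k j * B i l = (A *m G *m B) k l.
Proof.
rewrite mxE; apply: eq_bigr => i _; rewrite mxE big_distrl /=.
by apply: eq_bigr => j _; rewrite (mulrC (A k j)) ginvE.
Qed.

(** Moving indices by Codazzi turns nabla_i nabla_j h_kl into
    nabla_i nabla_k h_jl; commuting the two derivatives costs the four terms of
    [ricci_sff], and Codazzi again leads to nabla_k nabla_l h_ij, whose trace is
    the Hessian of H. Of the four terms, two cancel after contraction: both are
    h G h G h. *)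
Lemma laplacian_sff : \sum_i \sum_j G i j *: second_nabla i j h =
  hessian H + H *: W - sff_norm2 *: h.
Proof.
apply/matrixP => k l; rewrite !entryD entryN !entryZ hessian_tr1.
transitivity (\sum_i \sum_j (G i j * second_nabla k l h i j +
    (G i j * h i j * W k l - G i j * h k j * W i l +
     (G i j * W k j * h i l - G i j * W i j * h k l)))).
  rewrite summxE; apply: eq_bigr => i _; rewrite summxE; apply: eq_bigr => j _.
  rewrite entryZ (codazzi2 i j).
  rewrite -(subrK (second_nabla k i h j l) (second_nabla i k h j l)).
  by rewrite ricci_sff (second_nabla_sff_sym k i j l) (codazzi2 k i l j); ring.
have scale (S : 'M[K]_n) c :
    \sum_i \sum_j G i j * S i j * c = \tr (S *m G) * c.
  rewrite -contract_ginv big_distrl; apply: eq_bigr => i _.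
  by rewrite big_distrl.
under eq_bigr do rewrite !(big_split, sumrN) /=.
rewrite !(big_split, sumrN) /= !scale contract_ginv !contract_ginv2.
rewrite /H /sff_norm2 !mulmxA; ring.
Qed.

Definition norm_nabla_sff :=
  \sum_i \sum_j G i j * \tr (nabla i h *m G *m (nabla j h *m G)).

(** Half the Laplacian of |A|^2 is the product of h with its Laplacian plus
    |nabla A|^2. *)
Lemma simons_identity : laplace sff_norm2 =
  (\tr (hessian H *m G *m (h *m G)) + H * \tr (W *m G *m (h *m G))
   - sff_norm2 * sff_norm2 + norm_nabla_sff) *+ 2.
Proof.
have -> : laplace sff_norm2 =
    (\tr ((\sum_i \sum_j G i j *: second_nabla i j h) *m G *m (h *m G))
     + norm_nabla_sff) *+ 2.
  rewrite !mulmx_suml raddf_sum -big_split -sumrMnl /=; apply: eq_bigr => i _.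
  rewrite !mulmx_suml raddf_sum -big_split -sumrMnl /=; apply: eq_bigr => j _.
  rewrite hessian_tr2 mulrnAr mulrDr -!scalemxAl mxtraceZ.
  by congr ((_ + _ * _) *+ 2); rewrite mxtrace_mulC.
rewrite laplacian_sff !mulmxBl !mulmxDl -!scalemxAl !mxtraceE.
by rewrite {3}/sff_norm2; ring.
Qed.

(** * Evolution of the metric and of the second fundamental form *)

Section Flow.
Variable T : {additive K -> K}.
Hypothesis T_leibniz : leibniz T.
Hypothesis T_comm : forall i x, T (D i x) = D i (T x).
Hypothesis flow : map_mx T (map_mx T X) = H *: nu.

Local Notation dT := (map_mx T).

(** The normal components (nu, X_tk) of the velocities of the tangent vectors;
    up to sign, the components of the velocity of the normal. *)
Definition tilt : 'cV[K]_n := dT J *m nu^T.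
Definition tilt2 : K := ((tilt^T *m G *m tilt) : 'M[K]_1) 0 0.
Local Notation b := tilt.

Lemma tangent_derivation Y : dT (tangent Y) = tangent (dT Y).
Proof. by apply/matrixP => i a; rewrite !mxE T_comm. Qed.

Lemma normal_velocity : dT nu = - (b^T *m G *m J).
Proof. exact: weingarten_formula. Qed.

Lemma normal_velocity_norm : dT nu *m (dT nu)^T = tilt2%:M.
Proof.
rewrite /tilt2 -mx11_scalar normal_velocity !trmxE G_sym mulNmx mulmxN opprK.
by rewrite -!mulmxA (mulmxA J) (mulmxA G) G_inv mul1mx.
Qed.

Definition gradient f : 'cV[K]_n := \col_i D i f.

(** The time derivatives of X_i are those of X differentiated along i, so this
    is D_i (H nu) with D_i nu given by the Weingarten formula. *)
Lemma tangent_acceleration : dT (dT J) = gradient H *m nu - H *: (h *m G *m J).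
Proof.
have Dnu i a : D i (nu 0 a) = - (h *m G *m J) i a.
  have := weingarten_formula (D_leibniz i) => /matrixP/(_ 0 a).
  rewrite [LHS]mxE => ->; rewrite -/(sff_col i) sff_colE tr_col sff_sym.
  by rewrite -!row_mul [LHS]mxE [in LHS]mxE.
rewrite !tangent_derivation flow; apply/matrixP => i a.
rewrite mxE [in LHS]mxE D_leibniz Dnu entryD entryN entryZ mulmx_col_row.
by rewrite [gradient _ _ _]mxE mulrN.
Qed.

(** X_tti = D_i H nu - H h_i^p X_p has tangential part - H h_i^p X_p, and it
    enters twice. *)
Lemma metric_acceleration : dT (dT (J *m J^T)) =
  - (H *: h) *+ 2 + (dT J *m (dT J)^T) *+ 2.
Proof.
have hJ : h *m G *m J *m J^T = h by rewrite -!mulmxA G_inv mulmx1.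
have e : dT (dT J) *m J^T = - (H *: h).
  rewrite tangent_acceleration mulmxBl -(mulmxA _ nu) nu_normal' mulmx0 sub0r.
  by rewrite -scalemxAl hJ.
have e' : J *m (dT (dT J))^T = - (H *: h).
  by rewrite -[LHS]trmxK trmx_mul trmxK e -[in RHS]sff_sym linearN linearZ.
rewrite !map_mx_leibniz // map_mxD !map_mx_leibniz // -!map_trmx e e'.
by rewrite !mulr2n; apply/matrixP=> i j; rewrite !entryE; ring.
Qed.

Lemma ginv_velocity : dT G = - (G *m (dT (J *m J^T)) *m G).
Proof. exact: map_mx_leibniz_inv. Qed.

Local Notation g' := (dT (J *m J^T)).

Lemma ginv_acceleration : dT (dT G) = (G *m g' *m G *m g' *m G) *+ 2
  + (H *: (G *m h *m G)) *+ 2 - (G *m (dT J *m (dT J)^T) *m G) *+ 2.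
Proof.
have := metric_acceleration; have vel := ginv_velocity.
rewrite {1}vel; move: vel.
move: (dT (J *m J^T)) (dT J *m (dT J)^T) => v P vel acc.
rewrite map_mxN !map_mx_leibniz // vel acc !mulr2n !mxdistr -!scalemxAr.
rewrite -!scalemxAl !mulmxA; apply/matrixP => i j; rewrite !entryE; ring.
Qed.

(** The contraction of the time derivative of Gamma^p_ki with (nu, X_tp). *)
Definition christoffel_drift : 'M[K]_n :=
  \matrix_(k, i) (dT (Gam k) *m b) i 0.

(** h_k = (D_k X_i, nu) is a product, so its second derivative has three terms.
    The first contains D_k of the acceleration of J. In the other two D_k J is
    replaced by Gamma_k J + h_k nu; only the products of J and nu with the
    derivatives of nu are then needed, and those follow from differentiating
    J nu^T = 0 and nu nu^T = 1. The terms Gamma_k J_t nu_t^T cancel. *)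
Lemma sff_col_acceleration k : dT (dT (sff_col k)) =
  map_mx (D k) (gradient H) - Gam k *m gradient H - H *: (h *m G *m sff_col k)
  + tilt2 *: sff_col k - (dT (Gam k) *m b) *+ 2.
Proof.
have DT (p q : nat) (A : 'M[K]_(p, q)) :
    dT (map_mx (D k) A) = map_mx (D k) (dT A).
  by apply/matrixP => i a; rewrite !mxE T_comm.
have nn : dT nu *m nu^T = 0 := normal_derivation_normal T_leibniz.
have nn' : nu *m (dT nu)^T = 0.
  by rewrite -[LHS]trmxK trmx_mul trmxK nn trmx0.
have Jn : J *m (dT nu)^T = - b.
  rewrite normal_velocity !trmxE G_sym !mulmxN !mulmxA.
  by rewrite (mulmx1C G_inv) mul1mx.
have nn2 : nu *m (dT (dT nu))^T = - tilt2%:M.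
  have := map_mx_leibniz T_leibniz nu (dT nu)^T.
  rewrite nn' map_mx0 -map_trmx normal_velocity_norm => /esym/eqP.
  by rewrite addrC addr_eq0 => /eqP.
have Jn2 : J *m (dT (dT nu))^T = - gradient H - (dT J *m (dT nu)^T) *+ 2.
  have := map_mx_leibniz T_leibniz J (dT nu)^T.
  rewrite Jn map_mxN /tilt map_mx_leibniz // tangent_acceleration.
  rewrite mulmxBl -!mulmxA nu_unit mulmx1 -scalemxAl -!mulmxA nu_normal !mulmx0.
  rewrite scaler0 subr0 -!map_trmx => e.
  apply: (addrI (dT J *m (dT nu)^T)); rewrite -e mulr2n.
  by apply/matrixP => i j; rewrite !entryE; ring.
have e1 : dT (dT (map_mx (D k) J)) *m nu^T =
    map_mx (D k) (gradient H) - H *: (h *m G *m sff_col k).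
  rewrite !DT.
  have := map_mx_leibniz (D_leibniz k) (dT (dT J)) nu^T.
  rewrite tangent_acceleration [X in map_mx _ X](_ : _ = gradient H);
    last first.
    rewrite mulmxBl -scalemxAl -!mulmxA nu_unit mulmx1 nu_normal.
    by rewrite !mulmx0 scaler0 subr0.
  rewrite -[X in _ = _ + X](_ : H *: (h *m G *m sff_col k) = _).
    by move=> ->; rewrite addrK.
  rewrite -map_trmx weingarten_formula // !trmxE G_sym mulmxN mulmxBl.
  rewrite -/(sff_col k) -!mulmxA (mulmxA nu) nu_normal' mul0mx mulmx0 sub0r.
  rewrite opprK -scalemxAl -!mulmxA (mulmxA J J^T) (mulmxA G (J *m _)) G_inv.
  by rewrite mul1mx.
have e2 : dT (map_mx (D k) J) *m (dT nu)^T =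
    - (dT (Gam k) *m b) + Gam k *m (dT J *m (dT nu)^T) + tilt2 *: sff_col k.
  rewrite gauss_formula map_mxD; move: (Gam k) (sff_col k) => C c.
  rewrite !map_mx_leibniz // !mulmxDl -!mulmxA Jn nn'.
  rewrite normal_velocity_norm mulmx0 add0r mulmxN.
  by rewrite mul_mx_scalar.
have e3 : map_mx (D k) J *m (dT (dT nu))^T = Gam k *m (- gradient H)
   - (Gam k *m (dT J *m (dT nu)^T)) *+ 2 - tilt2 *: sff_col k.
  rewrite gauss_formula; move: (Gam k) (sff_col k) => C c.
  rewrite mulmxDl -!mulmxA Jn2 nn2 !mulr2n mulmxBr mulmxDr.
  by rewrite (mulmxN c) mul_mx_scalar.
have -> : dT (dT (sff_col k)) = dT (dT (map_mx (D k) J)) *m nu^T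
    + dT (map_mx (D k) J) *m (dT nu)^T *+ 2
    + map_mx (D k) J *m (dT (dT nu))^T.
  rewrite /sff_col; move: (map_mx (D k) J) => J'.
  rewrite map_mx_leibniz // map_mxD !map_mx_leibniz // -!map_trmx.
  by rewrite mulr2n !addrA.
rewrite e1 e2 e3 !mulr2n mulmxN; apply/matrixP => i j; rewrite !entryE; ring.
Qed.

Lemma sff_acceleration : dT (dT h) = hessian H - H *: W + tilt2 *: h
  - christoffel_drift *+ 2.
Proof.
apply/matrixP => k i.
have -> : dT (dT h) k i = dT (dT (sff_col k)) i 0 by rewrite !mxE.
rewrite sff_col_acceleration !mulr2n !(entryD, entryN, entryZ) -sffE.
have -> : (h *m G *m sff_col k) i 0 = W k i.
  have -> : W k i = W^T i k by rewrite [RHS]mxE.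
  rewrite !trmxE G_sym sff_sym sff_colE !mulmxA [LHS]mxE [RHS]mxE.
  by apply: eq_bigr => l _; rewrite [col _ _ _ _]mxE.
rewrite [hessian H k i]mxE [map_mx _ _ _ _]mxE [gradient _ _ _]mxE.
rewrite [(Gam k *m _) i 0]mxE [christoffel_drift k i]mxE.
under eq_bigr do rewrite [gradient _ _ _]mxE.
by ring.
Qed.

(** In the second derivative of tr (h G), H |A|^2 occurs with coefficient - 1
    through h_tt and + 2 through G_tt. *)
Lemma mean_curvature_acceleration : T (T H) = laplace H + H * sff_norm2
  - 2 * \tr (h *m G *m (dT J *m (dT J)^T *m G)) + H * tilt2
  - 2 * \tr (christoffel_drift *m G)
  + 2 * \tr (h *m G *m (g' *m G) *m (g' *m G))
  - 2 * \tr (dT h *m G *m (g' *m G)).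
Proof.
rewrite /laplace contract_ginv [T H]additive_mxtrace additive_mxtrace.
have -> : dT (dT (h *m G)) =
    dT (dT h) *m G + dT h *m dT G *+ 2 + h *m dT (dT G).
  rewrite map_mx_leibniz // map_mxD !map_mx_leibniz // mulr2n.
  by rewrite !addrA.
rewrite sff_acceleration ginv_acceleration ginv_velocity /sff_norm2 {2 4}/H.
move: (dT J *m (dT J)^T) g' (hessian _) christoffel_drift (dT h) => P v S Z h'.
rewrite !mulr2n !mxdistr -!scalemxAr -!scalemxAl !mulmxA !mxtraceE.
ring.
Qed.

(** The cubic terms H tr (h G h G h G) have coefficient - 2 through h_tt and + 4
    through G_tt; with the trace of Hess H G h G they form exactly the part of
    [simons_identity] that can be traded for Delta |A|^2, |nabla A|^2 and
    |A|^4. *)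
Lemma sff_norm2_acceleration : T (T sff_norm2) = laplace sff_norm2
  - 2 * norm_nabla_sff + 2 * sff_norm2 ^+ 2 + 2 * sff_norm2 * tilt2
  + 2 * \tr (dT h *m G *m (dT h *m G))
  - 8 * \tr (dT h *m G *m (h *m G) *m (g' *m G))
  - 4 * \tr (h *m G *m (h *m G) *m (dT J *m (dT J)^T *m G))
  + 2 * (2 * \tr (h *m G *m (h *m G) *m (g' *m G) *m (g' *m G)) +
         \tr (h *m G *m (g' *m G) *m (h *m G) *m (g' *m G)))
  - 4 * \tr (christoffel_drift *m G *m (h *m G)).
Proof.
have -> : T (T sff_norm2) = 2 * \tr (dT (dT (h *m G)) *m (h *m G)) +
    2 * \tr (dT (h *m G) *m dT (h *m G)).
  rewrite /sff_norm2 additive_mxtrace; move: (h *m G) => B.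
  rewrite additive_mxtrace map_mx_leibniz // map_mxD !map_mx_leibniz //.
  rewrite !mxtraceD (mxtrace_mulC B (dT (dT B))); ring.
have -> : dT (dT (h *m G)) =
    dT (dT h) *m G + dT h *m dT G *+ 2 + h *m dT (dT G).
  rewrite map_mx_leibniz // map_mxD !map_mx_leibniz // mulr2n.
  by rewrite !addrA.
rewrite (map_mx_leibniz T_leibniz h G) sff_acceleration ginv_acceleration.
rewrite ginv_velocity simons_identity.
have hT' : (dT h)^T = dT h by rewrite map_trmx sff_sym.
have gT' : g'^T = g' by rewrite map_trmx trmx_mul trmxK.
(* A trace of symmetric factors is also that of the reversed product; up to a
   cyclic permutation this exchanges h and g'. *)
have mirror : \tr (dT h *m G *m g' *m G *m h *m G) =
              \tr (dT h *m G *m h *m G *m g' *m G).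
  rewrite -[LHS]mxtrace_tr !trmx_mul G_sym hT' gT' sff_sym.
  by rewrite !mulmxA mxtrace_mulC !mulmxA.
have cyc1 : \tr (h *m G *m g' *m G *m dT h *m G) =
            \tr (dT h *m G *m h *m G *m g' *m G).
  by rewrite -(mulmxA _ (dT h)) mxtrace_mulC !mulmxA.
have cyc2 : \tr (h *m G *m g' *m G *m g' *m G *m h *m G) =
            \tr (h *m G *m h *m G *m g' *m G *m g' *m G).
  by rewrite -(mulmxA _ h G) mxtrace_mulC !mulmxA.
move: mirror cyc1 cyc2.
move: (dT J *m (dT J)^T) g' (hessian _) christoffel_drift (dT h).
move=> P v S Z d mirror cyc1 cyc2.
have cyc3 : \tr (h *m G *m P *m G *m h *m G) =
            \tr (h *m G *m h *m G *m P *m G).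
  by rewrite -(mulmxA _ h G) mxtrace_mulC !mulmxA.
have A2E : \tr (h *m G *m h *m G) = sff_norm2 by rewrite /sff_norm2 mulmxA.
rewrite !mulr2n !mxdistr -!scalemxAr -!scalemxAl !mulmxA.
rewrite !mxtraceE -?scalemxAl ?mxtraceZ mirror cyc1 cyc2 cyc3 A2E.
ring.
Qed.

End Flow.
End MovingFrame.

(** * Index sums as traces *)

Section IndexSums.
Variables (K : comPzRingType) (n : nat).

(** A trace runs over its indices in the order in which they are met along the
    cycle of factors, unlike the sums to which it is compared below. The proofs
    there reorder the sums one index at a time. *)
Lemma sum_pull3 (F : 'I_n -> 'I_n -> 'I_n -> K) :
  \sum_i \sum_j \sum_k F i j k = \sum_k \sum_i \sum_j F i j k.
Proof.
under eq_bigr do rewrite exchange_big.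
exact: exchange_big.
Qed.

Implicit Types A : 'M[K]_n.

Lemma mxtrace_mul2 A1 A2 :
  \tr (A1 *m A2) = \sum_i \sum_j A1 i j * A2 j i.
Proof. by apply: eq_bigr => i _; rewrite mxE. Qed.

Lemma mxtrace_mul4 A1 A2 A3 A4 : \tr (A1 *m A2 *m (A3 *m A4)) =
  \sum_i \sum_j \sum_k \sum_l A1 i j * A2 j k * A3 k l * A4 l i.
Proof.
rewrite -mulmxA mxtrace_mul2.
apply: eq_bigr => i _; apply: eq_bigr => j _; rewrite mxE big_distrr.
apply: eq_bigr => k _; rewrite /= mxE !big_distrr.
by apply: eq_bigr => l _; rewrite /= !mulrA.
Qed.

Lemma mxtrace_mul6 A1 A2 A3 A4 A5 A6 :
  \tr (A1 *m A2 *m (A3 *m A4) *m (A5 *m A6)) =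
  \sum_i \sum_j \sum_k \sum_l \sum_p \sum_q
    A1 i j * A2 j k * A3 k l * A4 l p * A5 p q * A6 q i.
Proof.
rewrite -!mulmxA (mulmxA A1) mxtrace_mul4; do 3!apply: eq_bigr => ? _.
apply: eq_bigr => l _; rewrite mxE big_distrr.
apply: eq_bigr => p _; rewrite /= mxE !big_distrr.
by apply: eq_bigr => q _; rewrite /= !mulrA.
Qed.

Lemma mxtrace_mul8 A1 A2 A3 A4 A5 A6 A7 A8 :
  \tr (A1 *m A2 *m (A3 *m A4) *m (A5 *m A6) *m (A7 *m A8)) =
  \sum_i \sum_j \sum_k \sum_l \sum_p \sum_q \sum_r \sum_s
    A1 i j * A2 j k * A3 k l * A4 l p * A5 p q * A6 q r * A7 r s * A8 s i.
Proof.
have -> : A1 *m A2 *m (A3 *m A4) *m (A5 *m A6) *m (A7 *m A8) =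
  A1 *m A2 *m (A3 *m A4) *m (A5 *m (A6 *m (A7 *m A8))) by rewrite !mulmxA.
rewrite mxtrace_mul6; do 5!apply: eq_bigr => ? _.
apply: eq_bigr => l _; rewrite mxE big_distrr.
apply: eq_bigr => p _; rewrite /= mxE !big_distrr.
by apply: eq_bigr => q _; rewrite /= !mulrA.
Qed.

Variables G h g' : 'M[K]_n.
Hypotheses (G_sym : G^T = G) (h_sym : h^T = h) (g'_sym : g'^T = g').

Let Gs i j : G i j = G j i. Proof. by rewrite -[in LHS]G_sym mxE. Qed.
Let hs i j : h i j = h j i. Proof. by rewrite -[in LHS]h_sym mxE. Qed.
Let gs i j : g' i j = g' j i. Proof. by rewrite -[in LHS]g'_sym mxE. Qed.

(** Contractions of a single monomial are named after the pairs of indices that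
    the inverse metrics G join. *)
Lemma contract_ik_jl (S P : 'M[K]_n) : P^T = P ->
  \sum_i \sum_j \sum_k \sum_l G i k * G j l * S i j * P k l =
  \tr (S *m G *m (P *m G)).
Proof.
move=> Ps; rewrite mxtrace_mul4; do 2!apply: eq_bigr => ? _.
rewrite exchange_big; apply: eq_bigr => l _; apply: eq_bigr => k _ /=.
by rewrite (Gs k) -[in LHS]Ps mxE; ring.
Qed.

Lemma contract_ij_kl (S P : 'M[K]_n) : P^T = P ->
  \sum_i \sum_j \sum_k \sum_l G i j * G k l * S i k * P j l =
  \tr (S *m G *m (P *m G)).
Proof.
move=> Ps; rewrite mxtrace_mul4; apply: eq_bigr => i _.
rewrite exchange_big; apply: eq_bigr => k _.
rewrite exchange_big; apply: eq_bigr => l _; apply: eq_bigr => j _ /=.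
by rewrite (Gs j) -[in LHS]Ps mxE; ring.
Qed.

Lemma contract_ik_jp_lq :
  \sum_i \sum_j \sum_k \sum_l \sum_p \sum_q
     G i k * G j p * G l q * h i j * g' p q * g' k l =
  \tr (h *m G *m (g' *m G) *m (g' *m G)).
Proof.
rewrite mxtrace_mul6; do 2!apply: eq_bigr => ? _.
rewrite sum_pull3; apply: eq_bigr => p _.
rewrite sum_pull3; apply: eq_bigr => q _.
rewrite exchange_big; apply: eq_bigr => l _; apply: eq_bigr => k _ /=.
by rewrite (gs l) (Gs q) (Gs k); ring.
Qed.

Lemma contract_im_jr_kl (S : 'M[K]_n) :
  \sum_i \sum_j \sum_k \sum_l \sum_m \sum_r
     G i m * G j r * G k l * h j l * g' m r * S i k =
  \tr (S *m G *m (h *m G) *m (g' *m G)).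
Proof.
rewrite mxtrace_mul6; apply: eq_bigr => i _.
rewrite exchange_big; apply: eq_bigr => k _.
rewrite exchange_big; apply: eq_bigr => l _; apply: eq_bigr => j _.
rewrite exchange_big; apply: eq_bigr => r _; apply: eq_bigr => m _ /=.
by rewrite (gs r) (hs l) (Gs m); ring.
Qed.

Lemma contract_quartic :
  \sum_i \sum_j \sum_k \sum_l \sum_m \sum_r \sum_p \sum_q
    G i m * g' p q * g' m r * h i k * h j l *
    (2 * G j p * G r q * G k l + G j r * G k p * G l q) =
  2 * \tr (h *m G *m (h *m G) *m (g' *m G) *m (g' *m G)) +
  \tr (h *m G *m (g' *m G) *m (h *m G) *m (g' *m G)).
Proof.
pose F1 i j k l m r p q := G i m * g' p q * g' m r * h i k * h j l *
  (G j p * G r q * G k l).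
pose F2 i j k l m r p q := G i m * g' p q * g' m r * h i k * h j l *
  (G j r * G k p * G l q).
transitivity (\sum_i \sum_j \sum_k \sum_l \sum_m \sum_r \sum_p \sum_q
  (F1 i j k l m r p q + F1 i j k l m r p q + F2 i j k l m r p q)).
  by do 8!apply: eq_bigr => ? _; rewrite /F1 /F2; ring.
transitivity (2 * (\sum_i \sum_j \sum_k \sum_l \sum_m \sum_r \sum_p \sum_q
    F1 i j k l m r p q) +
  \sum_i \sum_j \sum_k \sum_l \sum_m \sum_r \sum_p \sum_q F2 i j k l m r p q).
  rewrite mulr_natl mulr2n -!big_split /=.
  do 7!(apply: eq_bigr => ? _; rewrite -!big_split /=).
  by apply: eq_bigr.
congr (2 * _ + _).
  rewrite mxtrace_mul8; apply: eq_bigr => i _.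
  rewrite exchange_big; apply: eq_bigr => k _.
  rewrite exchange_big; apply: eq_bigr => l _; apply: eq_bigr => j _.
  rewrite sum_pull3; apply: eq_bigr => p _.
  rewrite sum_pull3; apply: eq_bigr => q _.
  rewrite exchange_big; apply: eq_bigr => r _; apply: eq_bigr => m _ /=.
  by rewrite /F1 (hs l) (Gs q) (gs r) (Gs m); ring.
rewrite mxtrace_mul8 sum_pull3; apply: eq_bigr => k _; apply: eq_bigr => i _.
rewrite sum_pull3; apply: eq_bigr => m _.
rewrite sum_pull3; apply: eq_bigr => r _; apply: eq_bigr => j _.
apply: eq_bigr => l _; rewrite exchange_big; apply: eq_bigr => q _.
apply: eq_bigr => p _ /=.
by rewrite /F2 (hs k) (Gs r) (gs q) (Gs p); ring.
Qed.

End IndexSums.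

(** * Maps of class C^k *)

Section ClassC.
Variables (R : realType) (V W : normedModType R).
Implicit Types (U : set V) (k : nat).

Lemma near_eq_differentiable (f g : V -> W) x :
  (\near x, f x = g x) -> differentiable f x -> differentiable g x.
Proof.
move=> fg df; have fgx : f x = g x := nbhs_singleton fg.
have dg : g \o shift x = cst (g x) + 'd f x +o_ 0 id.
  apply/eqaddoP => e e0; have /eqaddoP/(_ e e0) := diff_locally df.
  apply: filter_app; move: fg; rewrite (near_shift 0) subr0.
  by apply: filterS => h /= fgh; rewrite /= !fctE /= fgx fgh.
have e := diff_unique (diff_continuous df) dg.
apply/diff_locallyP; split; first by rewrite e; exact: diff_continuous.
by rewrite e; exact: dg.
Qed.

Lemma open_near_eq U (f g : V -> W) x : open U -> U x ->
  (forall y, U y -> f y = g y) -> \near x, f x = g x.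
Proof. by move=> Uo Ux fg; near do apply: fg; exact: open_nbhs_nbhs.
Unshelve. all: by end_near. Qed.

Lemma class_C_congr k U (f g : V -> W) : open U ->
  (forall x, U x -> f x = g x) -> class_C k U f -> class_C k U g.
Proof.
move=> Uo; elim: k f g => [|k IH] f g fg /=.
  move=> fc x Ux; change (g y @[y --> x] --> g x).
  rewrite -(fg _ Ux); apply: cvg_trans (fc _ Ux); apply: near_eq_cvg.
  by apply: open_near_eq Ux _ => // y Uy; rewrite fg.
move=> [df dDf]; split=> [x Ux|v].
  by apply: near_eq_differentiable (df _ Ux); exact: (open_near_eq Uo).
apply: IH (dDf v) => x Ux; apply: near_eq_derive.
exact: (open_near_eq Uo).
Qed.

Lemma class_CW k U (f : V -> W) : class_C k.+1 U f -> class_C k U f.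
Proof.
elim: k f => [|k IH] f /= [df dDf].
  by move=> x Ux; apply: differentiable_continuous (df _ Ux).
by split=> // v; apply: IH.
Qed.

Lemma class_C_cst k U (a : W) : class_C k U (cst a).
Proof.
elim: k a => [|k IH] a /=; first by move=> x _; exact: cst_continuous.
split=> [x _|v]; first exact: differentiable_cst.
rewrite (_ : 'D_v (cst a) = cst 0) //.
by apply/funext => x; rewrite derive_cst.
Qed.

Lemma class_CD k U (f g : V -> W) : open U ->
  class_C k U f -> class_C k U g -> class_C k U (f + g).
Proof.
move=> Uo; elim: k f g => [|k IH] f g /=.
  by move=> fc gc x Ux; apply: continuousD; [exact: fc|exact: gc].
move=> [df dDf] [dg dDg]; split=> [x Ux|v].
  by apply: differentiableD; [exact: df|exact: dg].
apply: (class_C_congr Uo _ (IH _ _ (dDf v) (dDg v))) => x Ux.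
by rewrite deriveD //; apply: diff_derivable; [exact: df|exact: dg].
Qed.

End ClassC.

Lemma class_C_coord (R : realType) (V : normedModType R) m n k (U : set V)
    (f : V -> 'M[R]_(m, n)) i j :
  open U -> class_C k U f -> class_C k U (fun x => f x i j).
Proof.
move=> Uo; elim: k f => [|k IH] f.
  move=> fc x Ux.
  apply: (@continuous_comp _ _ _ f (fun M : 'M[R]_(m, n) => M i j)).
    exact: fc.
  exact: coord_continuous.
move=> [df dDf]; split=> [x Ux|v].
  apply: (@differentiable_comp _ _ _ _ f (fun M : 'M[R]_(m, n) => M i j)).
    exact: df.
  exact: differentiable_coord.
apply: (class_C_congr Uo _ (IH _ (dDf v))) => x Ux.
by rewrite (derive_mx (diff_derivable (df x Ux))) mxE.
Qed.

Section ClassCReal.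
Variables (R : realType) (V : normedModType R).
Implicit Types (U : set V) (k : nat) (f g : V -> R).

Lemma class_CM k U f g : open U ->
  class_C k U f -> class_C k U g -> class_C k U (f * g).
Proof.
move=> Uo; elim: k f g => [|k IH] f g.
  by move=> fc gc x Ux; apply: continuousM; [exact: fc|exact: gc].
move=> Cf Cg; have [[df dDf] [dg dDg]] := (Cf, Cg); split=> [x Ux|v].
  by apply: differentiableM; [exact: df|exact: dg].
have C1 := IH _ _ (class_CW Cf) (dDg v).
have C2 := IH _ _ (class_CW Cg) (dDf v).
apply: (class_C_congr Uo _ (class_CD Uo C1 C2)) => x Ux.
by rewrite deriveM //; apply: diff_derivable; [exact: df|exact: dg].
Qed.

(** The derivative of 1 / f is - (1 / f)^2 f', so the claim for k gives it for
    k + 1. *)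
Lemma class_CV k U f : open U -> (forall x, U x -> f x != 0) ->
  class_C k U f -> class_C k U (fun x => (f x)^-1).
Proof.
move=> Uo f0; elim: k => [|k IH].
  by move=> fc x Ux; apply: continuousV; [exact: f0|exact: fc].
move=> Cf; have [df dDf] := Cf; split=> [x Ux|v].
  by apply: differentiableV; [exact: df|exact: f0].
have CV := IH (class_CW Cf); have CVV := class_CM Uo CV CV.
have C1 := class_CM Uo (class_C_cst k U (-1 : R)) (class_CM Uo CVV (dDf v)).
apply: (class_C_congr Uo _ C1) => x Ux.
rewrite deriveV; [|exact: f0|exact/diff_derivable/df].
by rewrite !fctE /cst mulN1r -expr2 exprVn scaleNr.
Qed.

End ClassCReal.

(** * Symmetry of second derivatives *)

Section Schwarz.
Variables (R : realType) (V : normedModType R).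
Implicit Types (U : set V) (f : V -> R) (u v p : V).

(** Mean value arguments take place on the line p + a u, with the point written
    [a *: u + p] as in the definition of the directional derivative. *)
Lemma is_derive_line f p u (s : R) : differentiable f (s *: u + p) ->
  is_derive s 1 (fun a => f (a *: u + p)) ('D_u f (s *: u + p)).
Proof.
move=> df.
have e : (fun h : R =>
         h^-1 *: (f ((h *: (1 : R) + s) *: u + p) - f (s *: u + p)))
       = (fun h => h^-1 *: (f (h *: u + (s *: u + p)) - f (s *: u + p))).
  apply/funext => h; congr (_ *: (f _ - _)).
  by rewrite scalerDl addrA /GRing.scale /= mulr1.
have du := diff_derivable (v := u) df.
by split; rewrite /derivable /derive /= e.
Qed.

Lemma mean_value_line f p u (s : R) : 0 < s ->
  (forall a, 0 <= a <= s -> differentiable f (a *: u + p)) ->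
  exists2 a, 0 <= a <= s & f (s *: u + p) - f p = 'D_u f (a *: u + p) * s.
Proof.
move=> s0 df; have /= := @MVT R (fun a => f (a *: u + p))
  (fun a => 'D_u f (a *: u + p)) 0 s s0.
rewrite scale0r add0r subr0; case.
- move=> a; rewrite in_itv /= => /andP[a0 as_].
  by apply/is_derive_line/df; rewrite !ltW.
- apply: derivable_within_continuous => a; rewrite in_itv /= => as_.
  by have [] := is_derive_line (df _ as_).
- move=> a; rewrite in_itv /= => /andP[a0 as_] e.
  by exists a => //; rewrite !ltW.
Qed.

(** The second difference of f over the parallelogram of sides s u and s v is
    symmetric in u and v, while two applications of the mean value theorem write
    it as s^2 times a value of D_v D_u f. *)
Lemma second_difference U f p u v (s : R) : 0 < s -> class_C 2 U f ->
  (forall a b, 0 <= a <= s -> 0 <= b <= s -> U (b *: v + (a *: u + p))) ->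
  exists a b, [/\ 0 <= a <= s, 0 <= b <= s &
    f (s *: v + (s *: u + p)) - f (s *: u + p) - (f (s *: v + p) - f p) =
    'D_v ('D_u f) (b *: v + (a *: u + p)) * s * s].
Proof.
move=> s0 [df dDf] Us.
have s00 : (0 : R) <= 0 <= s by apply/andP; split; lra.
have ss : 0 <= s <= s by apply/andP; split; lra.
have df1 a : 0 <= a <= s -> differentiable f (a *: u + p).
  by move=> as_; apply: df; have := Us a 0 as_ s00; rewrite scale0r add0r.
have df2 a : 0 <= a <= s -> differentiable f (s *: v + (a *: u + p)).
  by move=> as_; apply: df; exact: Us.
pose f' a := f (s *: v + (a *: u + p)) - f (a *: u + p).
pose df' a := 'D_u f (s *: v + (a *: u + p)) - 'D_u f (a *: u + p).
have drv a : 0 <= a <= s -> is_derive a 1 f' (df' a).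
  move=> as_; apply: is_deriveB; last exact/is_derive_line/df1.
  have e : (fun a => f (s *: v + (a *: u + p))) =
           (fun a => f (a *: u + (s *: v + p))).
    by apply/funext => b; rewrite addrCA.
  rewrite e addrCA; apply: is_derive_line; rewrite addrCA; exact: df2.
have [a as_ ea] : exists2 a, 0 <= a <= s & f' s - f' 0 = df' a * s.
  have := @MVT R f' df' 0 s s0; rewrite subr0; case.
  - move=> a; rewrite in_itv /= => /andP[a0 as_].
    by apply: drv; rewrite !ltW.
  - apply: derivable_within_continuous => a; rewrite in_itv /= => as_.
    by have [] := drv _ as_.
  - move=> a; rewrite in_itv /= => /andP[a0 as_] e.
    by exists a => //; rewrite !ltW.
have [b bs eb] : exists2 b, 0 <= b <= s &
    df' a = 'D_v ('D_u f) (b *: v + (a *: u + p)) * s.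
  apply: (@mean_value_line ('D_u f) (a *: u + p) v) => // b bs.
  by have [dDu _] := dDf u; apply: dDu; exact: Us.
exists a, b; split=> //.
by rewrite -eb -ea /f' scale0r add0r.
Qed.

(** By [second_difference] the continuous functions D_u D_v f and D_v D_u f take
    a common value at points as close to p as one likes. *)
Lemma derive_comm U f u v p : open U -> class_C 2 U f -> U p ->
  'D_u ('D_v f) p = 'D_v ('D_u f) p.
Proof.
move=> Uo Cf Up; have [_ dDf] := Cf.
have [_ cu] := dDf u; have [_ cv] := dDf v.
apply/eqP; rewrite -subr_eq0 -normr_le0; apply/ler_addgt0Pl => e e0.
rewrite addr0; have e2 : 0 < e / 2 by rewrite divr_gt0.
have [r1 /= r10 ball1] :=
  (nbhs_normP _ _).1 ((cvgrPdist_lt _ _).1 (cv u p Up) _ e2).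
have [r2 /= r20 ball2] :=
  (nbhs_normP _ _).1 ((cvgrPdist_lt _ _).1 (cu v p Up) _ e2).
have /(nbhs_normP _ _).1 [r3 /= r30 ball3] : nbhs p U.
  by apply: open_nbhs_nbhs; split.
pose r := Num.min r1 (Num.min r2 r3).
have r0 : 0 < r by rewrite !lt_min r10 r20.
have ball_r x : `|p - x| < r -> [/\ U x,
    `|'D_u ('D_v f) p - 'D_u ('D_v f) x| < e / 2 &
    `|'D_v ('D_u f) p - 'D_v ('D_u f) x| < e / 2].
  rewrite !lt_min => /and3P[x1 x2 x3].
  by split; [exact: ball3|exact: ball1|exact: ball2].
(* This side keeps the whole parallelogram within distance r of p, the + 1
   covering u = v = 0. *)
pose s := r / 2 / (`|u| + `|v| + 1).
have N0 : 0 < `|u| + `|v| + 1 by rewrite ltr_wpDl // addr_ge0.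
have s0 : 0 < s by rewrite !divr_gt0.
have near_p a b : 0 <= a <= s -> 0 <= b <= s ->
    `|p - (b *: v + (a *: u + p))| < r.
  move=> /andP[a0 as_] /andP[b0 bs].
  have -> : p - (b *: v + (a *: u + p)) = - (b *: v + a *: u).
    by rewrite (addrA (b *: v)) [X in p - X]addrC opprD addrA subrr add0r.
  rewrite normrN (le_lt_trans (ler_normD _ _)) // !normrZ !ger0_norm //.
  have : b * `|v| + a * `|u| <= s * `|v| + s * `|u|.
    by rewrite lerD // ler_wpM2r.
  move=> /le_lt_trans; apply.
  have -> : s * `|v| + s * `|u| = r / 2 - s.
    have <- : s * (`|u| + `|v| + 1) = r / 2 by rewrite /s divfK // gt_eqF.
    by ring.
  by lra.
have [a [b [as_ bs eab]]] := second_difference s0 Cf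
  (fun a b as_ bs => let: And3 Ux _ _ := ball_r _ (near_p a b as_ bs) in Ux).
have near_p' a' b' : 0 <= a' <= s -> 0 <= b' <= s ->
    `|p - (b' *: u + (a' *: v + p))| < r.
  by move=> as' bs'; rewrite addrCA; exact: near_p.
have [c [d [cs ds ecd]]] := second_difference s0 Cf
  (fun a b as_ bs => let: And3 Ux _ _ := ball_r _ (near_p' a b as_ bs) in Ux).
have [_ _ n1] := ball_r _ (near_p _ _ as_ bs).
have [_ n2 _] := ball_r _ (near_p' _ _ cs ds).
have exy : 'D_v ('D_u f) (b *: v + (a *: u + p)) =
         'D_u ('D_v f) (d *: u + (c *: v + p)).
  apply: (@mulIf _ s); first by rewrite gt_eqF.
  apply: (@mulIf _ s); first by rewrite gt_eqF.
  apply: (etrans (esym eab)); apply: etrans ecd.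
  rewrite (addrCA (s *: v)).
  by move: (f _) (f (s *: u + p)) (f (s *: v + p)) (f p) => f1 f2 f3 f4; ring.
move: n1 n2; rewrite exy; move: ('D_u _ (d *: u + _)) => z.
move: ('D_u _ p) ('D_v _ p) => x y n1 n2.
have -> : x - y = (x - z) - (y - z) by ring.
apply: (le_trans (ler_normB (x - z) (y - z))).
by rewrite [leRHS]splitr; apply: lerD; apply: ltW.
Qed.
End Schwarz.

(** * The ring of smooth functions on an open set *)

Section SmoothRing.
Variables (R : realType) (V : normedModType R) (U : set V) (Uo : open U).

(** Extension by 0 makes equality on U the equality of functions. The openness
    proof is an argument of the predicate because its closure properties depend
    on it, and instances are found from the predicate alone. *)
Definition extended_smooth (_ : open U) : {pred V -> R} :=
  fun f => `[< smooth_on U f /\ forall x, ~ U x -> f x = 0 >].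

Fact extended_smooth_zmod_closed : zmod_closed (extended_smooth Uo).
Proof.
split=> [|f g /asboolP[Cf f0] /asboolP[Cg g0]]; apply/asboolP; split=> //.
- by move=> k; exact: class_C_cst.
- move=> k; have CN := class_CM Uo (class_C_cst k U (-1 : R)) (Cg k).
  apply: (class_C_congr Uo _ (class_CD Uo (Cf k) CN)) => x _.
  by rewrite !fctE /cst mulN1r.
- by move=> x Ux; rewrite !fctE f0 // g0 // subr0.
Qed.

HB.instance Definition _ :=
  GRing.isZmodClosed.Build _ (extended_smooth Uo) extended_smooth_zmod_closed.

Record smooth_fun := SmoothFun {
  smooth_val :> V -> R;
  _ : smooth_val \in extended_smooth Uo
}.

HB.instance Definition _ := [isSub for smooth_val].
HB.instance Definition _ := [Choice of smooth_fun by <:].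
HB.instance Definition _ := [SubChoice_isSubZmodule of smooth_fun by <:].

Implicit Types F G : smooth_fun.

Lemma smooth_funP F : smooth_on U F.
Proof. by have /asboolP[] := valP F. Qed.

Lemma smooth_fun_out F x : ~ U x -> F x = 0.
Proof. by have /asboolP[_] := valP F; apply. Qed.

Lemma smooth_fun_eq F G : (forall x, U x -> F x = G x) -> F = G.
Proof.
move=> FG; apply/val_inj/funext => x /=.
by have [/FG//|Ux] := pselect (U x); rewrite !smooth_fun_out.
Qed.

Definition cutoff (f : V -> R) x := if `[< U x >] then f x else 0.

Lemma cutoff_in f x : U x -> cutoff f x = f x.
Proof. by rewrite /cutoff => /asboolP ->. Qed.

Fact cutoff_extended_smooth f : smooth_on U f ->
  cutoff f \in extended_smooth Uo.
Proof.
move=> Cf; apply/asboolP; split=> [k|x Ux].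
  by apply: (class_C_congr Uo _ (Cf k)) => x Ux; rewrite cutoff_in.
by rewrite /cutoff; case: asboolP.
Qed.

Definition of_smooth f (Cf : smooth_on U f) :=
  SmoothFun (cutoff_extended_smooth Cf).

Lemma of_smoothE f (Cf : smooth_on U f) x : U x -> of_smooth Cf x = f x.
Proof. exact: cutoff_in. Qed.

Fact smooth_on_cst (a : R) : smooth_on U (cst a).
Proof. by move=> k; exact: class_C_cst. Qed.

Fact smooth_onM F G : smooth_on U (smooth_val F * smooth_val G).
Proof. by move=> k; apply: class_CM => //; exact: smooth_funP. Qed.

Definition smooth_mul F G := of_smooth (smooth_onM F G).
(* The unit is the constant 1 on U only, so this is not a subring of the ring of
   all functions, and its product has to be declared separately. *)
Definition smooth_one := of_smooth (smooth_on_cst 1).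

Let valD F G x : (F + G) x = F x + G x. Proof. by []. Qed.

Fact smooth_mulE F G x : U x -> smooth_mul F G x = F x * G x.
Proof. exact: of_smoothE. Qed.

Fact smooth_mulA : associative smooth_mul.
Proof.
by move=> F G H; apply: smooth_fun_eq => x Ux; rewrite !smooth_mulE // mulrA.
Qed.

Fact smooth_mulC : commutative smooth_mul.
Proof.
by move=> F G; apply: smooth_fun_eq => x Ux; rewrite !smooth_mulE // mulrC.
Qed.

Fact smooth_mul1 : left_id smooth_one smooth_mul.
Proof.
move=> F; apply: smooth_fun_eq => x Ux.
by rewrite smooth_mulE // of_smoothE // mul1r.
Qed.

Fact smooth_mulD : left_distributive smooth_mul +%R.
Proof.
move=> F G H; apply: smooth_fun_eq => x Ux.
by rewrite valD !smooth_mulE // valD mulrDl.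
Qed.

HB.instance Definition _ := GRing.Zmodule_isComPzRing.Build smooth_fun
  smooth_mulA smooth_mulC smooth_mul1 smooth_mulD.

Lemma smooth_funD F G x : (F + G) x = F x + G x. Proof. by []. Qed.

Lemma smooth_funM F G x : U x -> (F * G) x = F x * G x.
Proof. exact: smooth_mulE. Qed.

Lemma smooth_fun1 x : U x -> (1 : smooth_fun) x = 1.
Proof. exact: of_smoothE. Qed.

Lemma smooth_fun_no_2torsion F : F + F = 0 -> F = 0.
Proof.
move=> FF; apply: smooth_fun_eq => x _.
have := congr1 (fun G : smooth_fun => G x) FF; rewrite smooth_funD.
by rewrite -mulr2n => /eqP; rewrite mulrn_eq0 /= => /eqP.
Qed.

Fact smooth_on_derive F v : smooth_on U ('D_v F).
Proof. by move=> k; have [_] := smooth_funP F k.+1; apply. Qed.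

Definition smooth_derive v F := of_smooth (smooth_on_derive F v).

Lemma smooth_deriveE v F x : U x -> smooth_derive v F x = 'D_v F x.
Proof. exact: of_smoothE. Qed.

Lemma smooth_fun_derivable F v x : U x -> derivable F x v.
Proof. by move=> Ux; have [d _] := smooth_funP F 1; exact/diff_derivable/d. Qed.

Fact smooth_derive_zmod v : zmod_morphism (smooth_derive v).
Proof.
move=> F G; apply: smooth_fun_eq => x Ux.
have sB (F' G' : smooth_fun) y : (F' - G') y = F' y - G' y by [].
rewrite sB !smooth_deriveE // -deriveB //; exact: smooth_fun_derivable.
Qed.

HB.instance Definition _ v := GRing.isZmodMorphism.Build smooth_fun smooth_fun
  (smooth_derive v) (smooth_derive_zmod v).

Lemma smooth_derive_leibniz v : leibniz (smooth_derive v).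
Proof.
move=> F G; apply: smooth_fun_eq => x Ux.
rewrite smooth_funD !smooth_funM // !smooth_deriveE //.
have -> : 'D_v (F * G) x = 'D_v (smooth_val F * smooth_val G) x.
  apply: near_eq_derive; apply: (open_near_eq Uo) => // y Uy.
  by rewrite smooth_funM.
rewrite deriveM; [|exact: smooth_fun_derivable..].
by rewrite addrC; congr (_ + _); exact: mulrC.
Qed.

Lemma smooth_derive_comm u v F :
  smooth_derive u (smooth_derive v F) = smooth_derive v (smooth_derive u F).
Proof.
have E a b x : U x ->
    smooth_derive a (smooth_derive b F) x = 'D_a ('D_b F) x.
  move=> Ux; rewrite smooth_deriveE //; apply: near_eq_derive.
  by apply: (open_near_eq Uo) => // y Uy; rewrite smooth_deriveE.
apply: smooth_fun_eq => x Ux.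
have eF := derive_comm u v Uo (smooth_funP F 2) Ux.
exact: etrans (E u v x Ux) (etrans eF (esym (E v u x Ux))).
Qed.

Fact smooth_on_inv F : (forall x, U x -> F x != 0) ->
  smooth_on U (fun x => (F x)^-1).
Proof. by move=> F0 k; apply: class_CV => //; exact: smooth_funP. Qed.

Section Evaluation.
Variables (x : V) (Ux : U x).

(** The proof that x lies in U is an argument because evaluation preserves the
    unit at points of U only. *)
Definition evaluation (_ : U x) F : R := F x.

Fact evaluation_zmod : zmod_morphism (evaluation Ux).
Proof. by []. Qed.
HB.instance Definition _ := GRing.isZmodMorphism.Build smooth_fun R
  (evaluation Ux) evaluation_zmod.

Fact evaluation_monoid : monoid_morphism (evaluation Ux).
Proof.
by split=> [|F G]; rewrite /evaluation ?smooth_fun1 ?smooth_funM.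
Qed.
HB.instance Definition _ := GRing.isMonoidMorphism.Build smooth_fun R
  (evaluation Ux) evaluation_monoid.

End Evaluation.
End SmoothRing.

(** * Functions of time and space as ring elements *)

Section SpaceTime.
Variables (R : realType) (n : nat).
Local Notation spacetime := (R * 'rV[R]_n)%type.

Definition uncurried (W : Type) (f : R -> 'rV[R]_n -> W) (p : spacetime) :=
  f p.1 p.2.

Definition time_dir : spacetime := (1, 0).
Definition space_dir (i : 'I_n) : spacetime := (0, delta_mx 0 i).

(** The partial derivatives of f are directional derivatives of its uncurried
    form by definition, even where f is not differentiable. *)
Lemma dt_uncurried (W : normedModType R) (f : R -> 'rV[R]_n -> W) p :
  uncurried (dt f) p = 'D_time_dir (uncurried f) p.
Proof.
case: p => t x; rewrite /uncurried /dt /derive1 /derive /=.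
apply: (congr1 (fun q : R -> W => lim (q h @[h --> 0^']))).
apply/funext => h /=.
by rewrite scaler0 add0r /GRing.scale /= mulr1.
Qed.

Lemma dx_uncurried (W : normedModType R) i (f : R -> 'rV[R]_n -> W) p :
  uncurried (dx i f) p = 'D_(space_dir i) (uncurried f) p.
Proof.
case: p => t x; rewrite /uncurried /dx /derive /=.
apply: (congr1 (fun q : R -> W => lim (q h @[h --> 0^']))).
apply/funext => h /=.
by rewrite scaler0 add0r.
Qed.

End SpaceTime.

Section Representation.
Variables (R : realType) (V : normedModType R) (U : set V) (Uo : open U).

Definition represents (F : smooth_fun Uo) (f : V -> R) :=
  forall p, U p -> F p = f p.

Definition represents_vec m (F : 'rV[smooth_fun Uo]_m) (f : V -> 'rV[R]_m) :=
  forall a, represents (F 0 a) (fun p => f p 0 a).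

Lemma represents_derive F f v :
  represents F f -> represents (smooth_derive v F) ('D_v f).
Proof.
move=> Ff p Up; rewrite smooth_deriveE //; apply: near_eq_derive.
exact: open_near_eq Uo Up Ff.
Qed.

(** f is derivable on U because each of its coordinates agrees there with a
    smooth function. *)
Lemma represents_vec_derive m (F : 'rV_m) f v :
  represents_vec F f -> represents_vec (map_mx (smooth_derive v) F) ('D_v f).
Proof.
move=> Ff a p Up; rewrite mxE (represents_derive v (Ff a)) //.
rewrite derive_mx ?mxE //; apply/derivable_mxP => i j; rewrite (ord1 i).
apply: (near_eq_derivable (open_near_eq Uo Up (Ff j))).
exact: smooth_fun_derivable.
Qed.

End Representation.

(** If v A A^T = 0 then |v A|^2 = v A A^T v^T = 0. *)
Lemma gram_unit (R : realFieldType) m n (A : 'M[R]_(m, n)) :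
  (forall v : 'rV_m, v *m A = 0 -> v = 0) -> A *m A^T \in unitmx.
Proof.
move=> A_inj; rewrite -row_free_unit; apply: inj_row_free => v vAA.
apply: A_inj; have : (v *m A) *m (v *m A)^T = 0.
  by rewrite trmx_mul !mulmxA -(mulmxA v) vAA mul0mx.
move: (v *m A) => w /matrixP/(_ 0 0); rewrite !mxE => /eqP.
rewrite psumr_eq0 => [/allP w0|i _]; last by rewrite mxE -expr2 sqr_ge0.
apply/rowP => a; have := w0 a; rewrite mem_index_enum mxE -expr2 sqrf_eq0.
by rewrite [RHS]mxE => /(_ isT)/eqP.
Qed.

(** * The evolution equations in a chart *)

(** The maps X and N are those of the theorem read in a chart with image C. The
    quantities of the theorem are represented, one after the other, by elements
    of the ring K of smooth functions on I x C; since derivatives respect this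
    representation, the identities proved in K can be evaluated at a point. *)
Section Chart.
Variables (R : realType) (n : nat) (I : set R) (C : set 'rV[R]_n).
Hypotheses (I_open : open I) (C_open : open C).
Variables X N : R -> 'rV[R]_n -> 'rV[R]_n.+1.
Local Notation dom := (I `*` C).
Hypothesis X_smooth : smooth_on dom (uncurried X).
Hypothesis N_smooth : smooth_on dom (uncurried N).
Hypothesis X_immersion : forall t x, I t -> C x -> injective ('d (X t) x).
Hypothesis N_unit : forall t x, I t -> C x -> inner (N t x) (N t x) = 1.
Hypothesis N_normal : forall t x, I t -> C x ->
  forall i, inner (N t x) (dx i X t x) = 0.
Hypothesis X_flow : forall t x, I t -> C x ->
  dt (dt X) t x = meanH X N t x *: N t x.

Let dom_open : open dom.
Proof.
rewrite openE => -[t x] [/= It Cx]; exists (I, C) => //=.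
by split; apply: open_nbhs_nbhs; split.
Qed.
Local Notation K := (smooth_fun dom_open).

Let T : {additive K -> K} := smooth_derive (time_dir R n).
Let D i : {additive K -> K} := smooth_derive (space_dir R i).

Let X_coord a : smooth_on dom (fun p => uncurried X p 0 a).
Proof. by move=> k; exact: class_C_coord. Qed.
Let N_coord a : smooth_on dom (fun p => uncurried N p 0 a).
Proof. by move=> k; exact: class_C_coord. Qed.

Let XK : 'rV[K]_n.+1 := \row_a of_smooth dom_open (@X_coord a).
Let NK : 'rV[K]_n.+1 := \row_a of_smooth dom_open (@N_coord a).
Let J := tangent D XK.

Let rep (F : K) f := represents F (uncurried f).
Let repv m (F : 'rV[K]_m) f := represents_vec F (uncurried f).

Let rep_dt F f : rep F f -> rep (T F) (dt f).
Proof.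
move=> Ff p Up; rewrite dt_uncurried; exact: represents_derive.
Qed.
Let rep_dx i F f : rep F f -> rep (D i F) (dx i f).
Proof.
move=> Ff p Up; rewrite dx_uncurried; exact: represents_derive.
Qed.
Let repv_dt m (F : 'rV[K]_m) f : repv F f -> repv (map_mx T F) (dt f).
Proof.
move=> Ff a p Up; rewrite dt_uncurried; exact: represents_vec_derive.
Qed.
Let repv_dx i m (F : 'rV[K]_m) f : repv F f -> repv (map_mx (D i) F) (dx i f).
Proof.
move=> Ff a p Up; rewrite dx_uncurried; exact: represents_vec_derive.
Qed.

Let repX : repv XK X.
Proof. by move=> a p Up; rewrite mxE of_smoothE. Qed.
Let repN : repv NK N.
Proof. by move=> a p Up; rewrite mxE of_smoothE. Qed.

Let repJ i : repv (row i J) (dx i X).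
Proof.
have -> : row i J = map_mx (D i) XK by apply/rowP => a; rewrite !mxE.
exact: repv_dx.
Qed.

Let rep_inner m (F G : 'rV[K]_m) f g : repv F f -> repv G g ->
  rep ((F *m G^T) 0 0) (fun t x => inner (f t x) (g t x)).
Proof.
move=> Ff Gg p Up.
have -> : ((F *m G^T) 0 0) p = evaluation Up ((F *m G^T) 0 0) by [].
rewrite mxE rmorph_sum; apply: eq_bigr => a _.
by rewrite rmorphM [G^T _ _]mxE; congr (_ * _); [exact: Ff|exact: Gg].
Qed.

Let g := J *m J^T.

Let rep_g i j : rep (g i j) (g_ X i j).
Proof.
have -> : g i j = (row i J *m (row j J)^T) 0 0.
  by rewrite !mxE; apply: eq_bigr => a _; rewrite !mxE.
exact: rep_inner.
Qed.
(* At each point the metric is the Gram matrix of the partial derivatives of X,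
   which are independent because the differential of X is injective. *)
Let gram_real p : dom p -> exists2 A : 'M[R]_(n, n.+1),
  (forall i j, (A *m A^T) i j = g_ X i j p.1 p.2) &
  (forall v : 'rV_n, v *m A = 0 -> v = 0).
Proof.
case: p => t x [/= It Cx]; exists (\matrix_(i, a) dx i X t x 0 a).
  by move=> i j; rewrite mxE; apply: eq_bigr => a _; rewrite !mxE.
move=> v v0; have dX : differentiable (X t) x.
  apply: (@differentiable_comp _ _ _ _ (fun y => (t, y)) (uncurried X)).
    by apply: differentiable_pair; [exact: differentiable_cst|].
  by have [d _] := X_smooth 1; apply: d.
apply: (X_immersion It Cx); rewrite linear0 {1}[v]row_sum_delta linear_sum.
rewrite -[RHS]v0; apply/rowP => a; rewrite summxE mxE; apply: eq_bigr => i _.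
by rewrite linearZ /= -deriveE // !mxE.
Qed.

Let gram_det p : dom p -> (\det g) p != 0.
Proof.
move=> Up; have -> : (\det g) p = evaluation Up (\det g) by [].
rewrite -det_map_mx; have [A gA A_inj] := gram_real Up.
have -> : map_mx (evaluation Up) g = A *m A^T.
  by apply/matrixP => i j; rewrite mxE gA; exact: rep_g.
by rewrite -unitfE -unitmxE gram_unit.
Qed.

(* The inverse metric by Cramer's rule, so that its entries are smooth. *)
Let dinv : K := of_smooth dom_open (smooth_on_inv gram_det).
Let G : 'M[K]_n := dinv *: \adj g.

Let g_sym : g^T = g.
Proof. by rewrite trmx_mul trmxK. Qed.

Let G_sym : G^T = G.
Proof. by rewrite linearZ /= trmx_adj g_sym. Qed.

Let G_inv : G *m g = 1%:M.
Proof.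
rewrite -scalemxAl mul_adj_mx scale_scalar_mx; congr (_%:M).
apply: smooth_fun_eq => p Up; rewrite smooth_funM // smooth_fun1 //.
by rewrite of_smoothE // mulVf // gram_det.
Qed.

Let rep_G i j : rep (G i j) (ginv X i j).
Proof.
move=> [t x] Up; rewrite /uncurried /ginv /=; set gr := \matrix_(k, l) _.
have e : map_mx (evaluation Up) G *m gr = 1%:M.
  have -> : gr = map_mx (evaluation Up) g.
    by apply/matrixP => k l; rewrite [LHS]mxE [RHS]mxE; exact/esym/rep_g.
  by rewrite -map_mxM G_inv map_mx1.
have [_ gu] := mulmx1_unit e.
have -> : invmx gr = map_mx (evaluation Up) G.
  by rewrite -[RHS]mulmx1 -(mulmxV gu) mulmxA e mul1mx.
by rewrite [RHS]mxE.
Qed.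

Let nu_unit : NK *m NK^T = 1%:M.
Proof.
apply/matrixP => i j; rewrite (ord1 i) (ord1 j) [RHS]mxE eqxx mulr1n.
apply: smooth_fun_eq => -[t x] Up; rewrite (rep_inner repN repN) //.
by rewrite [RHS]smooth_fun1 // /uncurried /= N_unit //; case: Up.
Qed.

Let nu_normal : J *m NK^T = 0.
Proof.
apply/matrixP => i j; rewrite (ord1 j) [RHS]mxE.
have -> : (J *m NK^T) i 0 = (row i J *m NK^T) 0 0.
  by rewrite -row_mul [RHS]mxE.
apply: smooth_fun_eq => -[t x] Up; rewrite (rep_inner (@repJ i) repN) //.
rewrite /uncurried /= /inner; under eq_bigr do rewrite mulrC.
by apply: N_normal; case: Up.
Qed.

Let h := sff D XK NK.

Let rep_h i j : rep (h i j) (h_ X N i j).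
Proof.
have -> : h i j = (map_mx (D i) (row j J) *m NK^T) 0 0.
  by rewrite !mxE; apply: eq_bigr => a _; rewrite !mxE.
by apply: rep_inner => //; exact: repv_dx.
Qed.

Let D_leibniz i : leibniz (D i).
Proof. exact: smooth_derive_leibniz. Qed.
Let D_comm i j (F : K) : D i (D j F) = D j (D i F).
Proof. exact: smooth_derive_comm. Qed.
Let T_leibniz : leibniz T.
Proof. exact: smooth_derive_leibniz. Qed.
Let T_comm i (F : K) : T (D i F) = D i (T F).
Proof. exact: smooth_derive_comm. Qed.

Let Gam := christoffel D XK G.

Let rep_Gam k i l : rep (Gam k i l) (Gamma X l k i).
Proof.
move=> [t x] Up; rewrite /uncurried /Gamma /=.
have := congr1 (evaluation Up)
  (christoffel_koszul D_leibniz D_comm XK G_sym k i l).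
rewrite raddfMn rmorph_sum => e.
have -> : Gam k i l (t, x) = evaluation Up (Gam k i l) by [].
apply: (@mulIf _ 2); rewrite ?pnatr_eq0 // mulr_natr e mulrAC.
rewrite mulVf ?pnatr_eq0 // mul1r; apply: eq_bigr => q _.
rewrite rmorphM rmorphB rmorphD.
congr (_ * (_ + _ - _)).
- exact: rep_G.
- exact: (rep_dx _ (rep_g _ _)).
- exact: (rep_dx _ (rep_g _ _)).
- exact: (rep_dx _ (rep_g _ _)).
Qed.

Let H := mean_curvature D XK NK G.
Let A2 := sff_norm2 D XK NK G.

Let rep_H : rep H (meanH X N).
Proof.
move=> [t x] Up; rewrite /uncurried /meanH /=.
have -> : H (t, x) = evaluation Up H by [].
rewrite /H /mean_curvature -(contract_ginv G_sym) rmorph_sum.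
apply: eq_bigr => i _; rewrite rmorph_sum; apply: eq_bigr => j _.
by rewrite rmorphM; congr (_ * _); [exact: rep_G|exact: rep_h].
Qed.

Let h_sym : h^T = h.
Proof. exact: sff_sym. Qed.

Let rep_A2 : rep A2 (normA2 X N).
Proof.
move=> [t x] Up; rewrite /uncurried /normA2 /=.
have -> : A2 (t, x) = evaluation Up A2 by [].
rewrite /A2 /sff_norm2 -(contract_ij_kl G_sym _ h_sym) rmorph_sum.
apply: eq_bigr => i _; rewrite rmorph_sum; apply: eq_bigr => j _.
rewrite rmorph_sum; apply: eq_bigr => k _.
rewrite rmorph_sum; apply: eq_bigr => l _; rewrite !rmorphM.
by congr (_ * _ * _ * _); [exact: rep_G|exact: rep_G|exact: rep_h|exact: rep_h].
Qed.

Let rep_laplace F f : rep F f -> rep (laplace D XK G F) (laplacian X f).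
Proof.
move=> Ff [t x] Up; rewrite /uncurried /laplacian /=.
have -> : laplace D XK G F (t, x) = evaluation Up (laplace D XK G F) by [].
rewrite rmorph_sum; apply: eq_bigr => i _; rewrite rmorph_sum.
apply: eq_bigr => j _; rewrite rmorphM [hessian _ _ _ _ _ _]mxE.
rewrite rmorphB rmorph_sum.
congr (_ * (_ - _)); first exact: rep_G.
  exact: (rep_dx i (rep_dx j Ff)).
apply: eq_bigr => l _; rewrite rmorphM; congr (_ * _); first exact: rep_Gam.
exact: (rep_dx l Ff).
Qed.

Let rep_nabla k i j : rep (nabla D XK G k h i j) (nabla2 X (h_ X N) k i j).
Proof.
move=> [t x] Up; rewrite /uncurried /nabla2 /=.
have -> : nabla D XK G k h i j (t, x) =
  evaluation Up (nabla D XK G k h i j) by [].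
rewrite mxE !rmorphB !rmorph_sum; congr (_ - _ - _).
- exact: (rep_dx k (rep_h i j)).
- apply: eq_bigr => l _; rewrite rmorphM.
  by congr (_ * _); [exact: rep_Gam|exact: rep_h].
- apply: eq_bigr => l _; rewrite rmorphM.
  by congr (_ * _); [exact: rep_Gam|exact: rep_h].
Qed.

Let rep_norm_nabla : rep (norm_nabla_sff D XK NK G) (norm_nablaA2 X N).
Proof.
move=> [t x] Up; rewrite /uncurried /norm_nablaA2 /=.
pose e : {rmorphism K -> R} := evaluation Up.
have -> : norm_nabla_sff D XK NK G (t, x) = e (norm_nabla_sff D XK NK G) by [].
rewrite rmorph_sum; apply: eq_bigr => k _; rewrite rmorph_sum.
apply: eq_bigr => r _.
have nS : (nabla D XK G r h)^T = nabla D XK G r h by rewrite nabla_tr h_sym.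
rewrite rmorphM -(contract_ij_kl G_sym _ nS) rmorph_sum mulr_sumr.
apply: eq_bigr => i _; rewrite rmorph_sum mulr_sumr.
apply: eq_bigr => a _; rewrite rmorph_sum mulr_sumr.
apply: eq_bigr => j _; rewrite rmorph_sum mulr_sumr.
apply: eq_bigr => b _; rewrite !rmorphM !mulrA.
congr (_ * _ * _ * _ * _); try exact: rep_G; exact: rep_nabla.
Qed.

Let flow : map_mx T (map_mx T XK) = H *: NK.
Proof.
apply/rowP => a; apply: smooth_fun_eq => -[t x] Up.
rewrite (repv_dt (repv_dt repX)) //.
rewrite [RHS](_ : _ = (H * NK 0 a) (t, x)); last first.
  by rewrite mxE.
rewrite smooth_funM // (rep_H Up) (repN a Up) /uncurried /= X_flow ?mxE //.
  by case: Up.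
by case: Up.
Qed.

Variables (t : R) (x : 'rV[R]_n).
Hypotheses (It : I t) (Cx : C x).
Let Up : dom (t, x) := conj It Cx.
Let e : {rmorphism K -> R} := evaluation Up.

Let Gr := map_mx e G.
Let hr := map_mx e h.
Let vr := map_mx e (map_mx T g).
Let dr := map_mx e (map_mx T h).
Let Pr := map_mx e (map_mx T J *m (map_mx T J)^T).
Let Zr := map_mx e (christoffel_drift D XK NK G T).

Let Xt k := dt (dx k X) t x.
Let NXt k := inner (N t x) (Xt k).

Let GrE i j : ginv X i j t x = Gr i j.
Proof. by rewrite mxE; exact/esym/rep_G. Qed.
Let hrE i j : h_ X N i j t x = hr i j.
Proof. by rewrite mxE; exact/esym/rep_h. Qed.
Let vrE i j : dt (g_ X i j) t x = vr i j.
Proof.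
rewrite [RHS]mxE [map_mx T g i j]mxE; exact: esym (rep_dt (rep_g i j) Up).
Qed.
Let drE i j : dt (h_ X N i j) t x = dr i j.
Proof.
rewrite [RHS]mxE [map_mx T h i j]mxE; exact: esym (rep_dt (rep_h i j) Up).
Qed.

Let PrE k l : inner (Xt k) (Xt l) = Pr k l.
Proof.
have -> : Pr k l =
    e ((map_mx T (row k J) *m (map_mx T (row l J))^T) 0 0).
  rewrite [LHS]mxE; congr (e _).
  by rewrite !mxE; apply: eq_bigr => a _; rewrite !mxE.
exact: esym (rep_inner (repv_dt (@repJ k)) (repv_dt (@repJ l)) Up).
Qed.

Let tiltE k : e (tilt D XK NK T k 0) = NXt k.
Proof.
have -> : tilt D XK NK T k 0 = (NK *m (map_mx T (row k J))^T) 0 0.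
  by rewrite !mxE; apply: eq_bigr => a _; rewrite !mxE mulrC.
exact: rep_inner repN (repv_dt (@repJ k)) _ Up.
Qed.

Let tilt2E : e (tilt2 D XK NK G T) = \sum_k \sum_l Gr k l * NXt k * NXt l.
Proof.
have -> : tilt2 D XK NK G T = \sum_k \sum_l G k l *
    tilt D XK NK T k 0 * tilt D XK NK T l 0.
  rewrite /tilt2 -mulmxA mxE; apply: eq_bigr => k _.
  rewrite [_^T _ _]mxE [(G *m _) _ _]mxE mulr_sumr; apply: eq_bigr => l _.
  by rewrite mulrA (mulrC (tilt _ _ _ _ _ _)).
rewrite rmorph_sum; apply: eq_bigr => k _; rewrite rmorph_sum.
by apply: eq_bigr => l _; rewrite !rmorphM !tiltE [Gr k l]mxE.
Qed.

Let ZrE k i : \sum_p dt (Gamma X p k i) t x * NXt p = Zr k i.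
Proof.
rewrite [RHS]mxE [christoffel_drift _ _ _ _ _ _ _]mxE mxE rmorph_sum.
apply: eq_bigr => p _; rewrite rmorphM tiltE mxE; congr (_ * _).
exact: esym (rep_dt (rep_Gam k i p) Up).
Qed.

Let Gr_sym : Gr^T = Gr. Proof. by rewrite map_trmx G_sym. Qed.
Let hr_sym : hr^T = hr. Proof. by rewrite map_trmx h_sym. Qed.
Let vr_sym : vr^T = vr. Proof. by rewrite !map_trmx g_sym. Qed.
Let dr_sym : dr^T = dr. Proof. by rewrite !map_trmx h_sym. Qed.
Let Pr_sym : Pr^T = Pr. Proof. by rewrite map_trmx trmx_mul trmxK. Qed.

(* [rmorph_nat] comes first: the numeral 2 unifies with 1 + 1, which [rmorphD]
   would split. *)
Let eE := (rmorph_nat, rmorphB, rmorphD, rmorphM, rmorphXn).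

Let e_tr2 (A B : 'M[K]_n) : e (\tr (A *m B)) = \tr (map_mx e A *m map_mx e B).
Proof. by rewrite -trace_map_mx map_mxM. Qed.

Let e_tr4 (B1 B2 B3 B4 : 'M[K]_n) : e (\tr (B1 *m B2 *m (B3 *m B4))) =
  \tr (map_mx e B1 *m map_mx e B2 *m (map_mx e B3 *m map_mx e B4)).
Proof. by rewrite e_tr2 !map_mxM. Qed.

Let e_tr6 (B1 B2 B3 B4 B5 B6 : 'M[K]_n) :
  e (\tr (B1 *m B2 *m (B3 *m B4) *m (B5 *m B6))) =
  \tr (map_mx e B1 *m map_mx e B2 *m (map_mx e B3 *m map_mx e B4) *m
       (map_mx e B5 *m map_mx e B6)).
Proof. by rewrite e_tr2 !map_mxM. Qed.

Let e_tr8 (B1 B2 B3 B4 B5 B6 B7 B8 : 'M[K]_n) :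
  e (\tr (B1 *m B2 *m (B3 *m B4) *m (B5 *m B6) *m (B7 *m B8))) =
  \tr (map_mx e B1 *m map_mx e B2 *m (map_mx e B3 *m map_mx e B4) *m
       (map_mx e B5 *m map_mx e B6) *m (map_mx e B7 *m map_mx e B8)).
Proof. by rewrite e_tr2 !map_mxM. Qed.

Lemma chart_mean_curvature_acceleration : dt (dt (meanH X N)) t x =
  laplacian X (meanH X N) t x + meanH X N t x * normA2 X N t x
  - 2 * \tr (hr *m Gr *m (Pr *m Gr))
  + meanH X N t x * (\sum_k \sum_l Gr k l * NXt k * NXt l)
  - 2 * \tr (Zr *m Gr)
  + 2 * \tr (hr *m Gr *m (vr *m Gr) *m (vr *m Gr))
  - 2 * \tr (dr *m Gr *m (vr *m Gr)).
Proof.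
have E (L H' A s1 b s2 s3 s4 : K) :
    e (L + H' * A - 2 * s1 + H' * b - 2 * s2 + 2 * s3 - 2 * s4) =
    e L + e H' * e A - 2 * e s1 + e H' * e b - 2 * e s2 + 2 * e s3 - 2 * e s4.
  by rewrite !eE.
have := congr1 e (mean_curvature_acceleration D_leibniz D_comm
  (@smooth_fun_no_2torsion _ _ _ _) (esym (addn1 n)) G_sym G_inv nu_unit
  nu_normal T_leibniz T_comm flow).
move=> /(etrans (esym (rep_dt (rep_dt rep_H) Up))) flowE.
apply: (etrans flowE); apply: (etrans (E _ _ _ _ _ _ _ _)).
have eH : e H = meanH X N t x := rep_H Up.
congr (_ + _ * _ - 2 * _ + _ * _ - 2 * _ + 2 * _ - 2 * _).
- exact: (rep_laplace rep_H Up).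
- exact: eH.
- exact: (rep_A2 Up).
- exact: e_tr4.
- exact: eH.
- exact: tilt2E.
- exact: e_tr2.
- exact: e_tr6.
- exact: e_tr4.
Qed.

Lemma chart_sff_norm2_acceleration : dt (dt (normA2 X N)) t x =
  laplacian X (normA2 X N) t x - 2 * norm_nablaA2 X N t x
  + 2 * normA2 X N t x ^+ 2
  + 2 * normA2 X N t x * (\sum_k \sum_l Gr k l * NXt k * NXt l)
  + 2 * \tr (dr *m Gr *m (dr *m Gr))
  - 8 * \tr (dr *m Gr *m (hr *m Gr) *m (vr *m Gr))
  - 4 * \tr (hr *m Gr *m (hr *m Gr) *m (Pr *m Gr))
  + 2 * (2 * \tr (hr *m Gr *m (hr *m Gr) *m (vr *m Gr) *m (vr *m Gr)) +
         \tr (hr *m Gr *m (vr *m Gr) *m (hr *m Gr) *m (vr *m Gr)))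
  - 4 * \tr (Zr *m Gr *m (hr *m Gr)).
Proof.
have E (L M A b s1 s2 s3 s4 s5 s6 : K) :
    e (L - 2 * M + 2 * A ^+ 2 + 2 * A * b + 2 * s1 - 8 * s2 - 4 * s3
       + 2 * (2 * s4 + s5) - 4 * s6) =
    e L - 2 * e M + 2 * e A ^+ 2 + 2 * e A * e b + 2 * e s1 - 8 * e s2
       - 4 * e s3 + 2 * (2 * e s4 + e s5) - 4 * e s6.
  by rewrite !eE.
have := congr1 e (sff_norm2_acceleration D_leibniz D_comm
  (@smooth_fun_no_2torsion _ _ _ _) (esym (addn1 n)) G_sym G_inv nu_unit
  nu_normal T_leibniz T_comm flow).
move=> /(etrans (esym (rep_dt (rep_dt rep_A2) Up))) flowE.
apply: (etrans flowE); apply: (etrans (E _ _ _ _ _ _ _ _ _ _)).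
have eA : e A2 = normA2 X N t x := rep_A2 Up.
congr (_ - 2 * _ + 2 * _ ^+ 2 + 2 * _ * _ + 2 * _ - 8 * _ - 4 * _
       + 2 * (2 * _ + _) - 4 * _).
- exact: (rep_laplace rep_A2 Up).
- exact: (rep_norm_nabla Up).
- exact: eA.
- exact: eA.
- exact: tilt2E.
- exact: e_tr4.
- exact: e_tr6.
- exact: e_tr6.
- exact: e_tr8.
- exact: e_tr8.
- exact: e_tr4.
Qed.

Lemma chart_evolution_equations :
  let Hc := meanH X N in
  let A2 := normA2 X N in
  let gi i j := ginv X i j t x in
  let h i j := h_ X N i j t x in
  let g' i j := dt (g_ X i j) t x in
  let h' i j := dt (h_ X N i j) t x in
  let Gamma' k i j := dt (Gamma X k i j) t x in
  let Xt k := dt (dx k X) t x in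
  let NXt k := inner (N t x) (Xt k) in
  (dt (dt Hc) t x =
     laplacian X Hc t x + Hc t x * A2 t x
     - 2 * (\sum_i \sum_j \sum_k \sum_l
              gi i k * gi j l * h i j * inner (Xt k) (Xt l))
     + Hc t x * (\sum_k \sum_l gi k l * NXt k * NXt l)
     - 2 * (\sum_i \sum_j \sum_k gi i j * Gamma' k i j * NXt k)
     + 2 * (\sum_i \sum_j \sum_k \sum_l \sum_p \sum_q
              gi i k * gi j p * gi l q * h i j * g' p q * g' k l)
     - 2 * (\sum_i \sum_j \sum_k \sum_l gi i k * gi j l * g' k l * h' i j))
  /\
  (dt (dt A2) t x =
     laplacian X A2 t x - 2 * norm_nablaA2 X N t x + 2 * A2 t x ^+ 2
     + 2 * A2 t x * (\sum_p \sum_q gi p q * NXt p * NXt q)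
     + 2 * (\sum_i \sum_j \sum_k \sum_l gi i j * gi k l * h' i k * h' j l)
     - 8 * (\sum_i \sum_j \sum_k \sum_l \sum_m \sum_r
              gi i m * gi j r * gi k l * h j l * g' m r * h' i k)
     - 4 * (\sum_i \sum_j \sum_k \sum_l \sum_m \sum_r
              gi i m * gi j r * gi k l * h i k * h j l * inner (Xt m) (Xt r))
     + 2 * (\sum_i \sum_j \sum_k \sum_l \sum_m \sum_r \sum_p \sum_q
              gi i m * g' p q * g' m r * h i k * h j l *
              (2 * gi j p * gi r q * gi k l + gi j r * gi k p * gi l q))
     - 4 * (\sum_i \sum_j \sum_k \sum_l \sum_p
              gi i j * gi k l * h j l * Gamma' p i k * NXt p)).
Proof.
move=> Hc A2c gi hc g' h' Gamma' Xt' NXt'.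
have giE : gi = fun_of_matrix Gr.
  by apply/funext => i; apply/funext => j; exact: GrE.
have hE : hc = fun_of_matrix hr.
  by apply/funext => i; apply/funext => j; exact: hrE.
have g'E : g' = fun_of_matrix vr.
  by apply/funext => i; apply/funext => j; exact: vrE.
have h'E : h' = fun_of_matrix dr.
  by apply/funext => i; apply/funext => j; exact: drE.
have PE i j : inner (Xt' i) (Xt' j) = Pr i j by exact: PrE.
have ZE k i : Zr k i = \sum_p Gamma' p k i * NXt' p by exact/esym/ZrE.
rewrite giE hE g'E h'E; clear giE hE g'E h'E gi hc g' h'.
split.
- apply: (etrans chart_mean_curvature_acceleration).
  congr (_ + _ - 2 * _ + _ * _ - 2 * _ + 2 * _ - 2 * _).
  + rewrite -(contract_ik_jl Gr_sym hr Pr_sym).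
    by do 4!(apply: eq_bigr => ? _); rewrite PE.
  + rewrite -(contract_ginv Gr_sym); do 2!(apply: eq_bigr => ? _).
    by rewrite ZE mulr_sumr; apply: eq_bigr => k _; rewrite mulrA.
  + exact/esym/contract_ik_jp_lq.
  + rewrite -(contract_ik_jl Gr_sym dr vr_sym).
    by do 4!(apply: eq_bigr => ? _); rewrite mulrAC.
- apply: (etrans chart_sff_norm2_acceleration).
  congr (_ - _ + _ + _ * _ + 2 * _ - 8 * _ - 4 * _ + 2 * _ - 4 * _).
  + exact/esym/contract_ij_kl.
  + exact/esym/contract_im_jr_kl.
  + rewrite -(contract_im_jr_kl Gr_sym hr_sym Pr_sym hr).
    do 6!(apply: eq_bigr => ? _); rewrite PE; ring.
  + exact/esym/contract_quartic.
  + rewrite -(contract_ij_kl Gr_sym Zr hr_sym).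
    do 4!(apply: eq_bigr => ? _); rewrite ZE mulr_sumr mulr_suml.
    by apply: eq_bigr => p _; rewrite mulrAC mulrA.
Qed.

End Chart.

Theorem theorem5p2 (R : realType) (n : nat) (M : smooth_manifold R n)
    (I : set R) (X N : R -> M -> 'rV[R]_n.+1)
    (I_itv : is_interval I) (I_open : open I)
    (X_imm : immersion_family I X)
    (N_normal : unit_normal_family I X N)
    (X_flow : hyperbolic_mcf I X N)
    (c : chart R n M) (c_atlas : atlas c)
    (t : R) (It : I t) (x : 'rV[R]_n) (cx : chart_cod c x) :
  let Xc := in_chart X c in
  let Nc := in_chart N c in
  let Hc := meanH Xc Nc in
  let A2 := normA2 Xc Nc in
  let gi i j := ginv Xc i j t x in
  let h i j := h_ Xc Nc i j t x in
  let g' i j := dt (g_ Xc i j) t x in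
  let h' i j := dt (h_ Xc Nc i j) t x in
  let Gamma' k i j := dt (Gamma Xc k i j) t x in
  let Xt k := dt (dx k Xc) t x in
  let NXt k := inner (Nc t x) (Xt k) in
  (dt (dt Hc) t x =
     laplacian Xc Hc t x + Hc t x * A2 t x
     - 2 * (\sum_i \sum_j \sum_k \sum_l
              gi i k * gi j l * h i j * inner (Xt k) (Xt l))
     + Hc t x * (\sum_k \sum_l gi k l * NXt k * NXt l)
     - 2 * (\sum_i \sum_j \sum_k gi i j * Gamma' k i j * NXt k)
     + 2 * (\sum_i \sum_j \sum_k \sum_l \sum_p \sum_q
              gi i k * gi j p * gi l q * h i j * g' p q * g' k l)
     - 2 * (\sum_i \sum_j \sum_k \sum_l gi i k * gi j l * g' k l * h' i j))
  /\
  (dt (dt A2) t x =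
     laplacian Xc A2 t x - 2 * norm_nablaA2 Xc Nc t x + 2 * A2 t x ^+ 2
     + 2 * A2 t x * (\sum_p \sum_q gi p q * NXt p * NXt q)
     + 2 * (\sum_i \sum_j \sum_k \sum_l gi i j * gi k l * h' i k * h' j l)
     - 8 * (\sum_i \sum_j \sum_k \sum_l \sum_m \sum_r
              gi i m * gi j r * gi k l * h j l * g' m r * h' i k)
     - 4 * (\sum_i \sum_j \sum_k \sum_l \sum_m \sum_r
              gi i m * gi j r * gi k l * h i k * h j l * inner (Xt m) (Xt r))
     + 2 * (\sum_i \sum_j \sum_k \sum_l \sum_m \sum_r \sum_p \sum_q
              gi i m * g' p q * g' m r * h i k * h j l *
              (2 * gi j p * gi r q * gi k l + gi j r * gi k p * gi l q))
     - 4 * (\sum_i \sum_j \sum_k \sum_l \sum_p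
              gi i j * gi k l * h j l * Gamma' p i k * NXt p)).
Proof.
move: X_imm N_normal => [X_smooth X_inj] [N_smooth N_unit N_orth].
apply: (@chart_evolution_equations R n I (chart_cod c) I_open
  (@chart_cod_open _ _ _ c) (in_chart X c) (in_chart N c)) => //.
- exact: X_smooth.
- exact: N_smooth.
- by move=> t' x' It' Cx'; exact: X_inj.
- by move=> t' x' It' Cx'; exact: N_unit.
- by move=> t' x' It' Cx' i; exact: N_orth.
- by move=> t' x' It' Cx'; exact: X_flow.
Qed.
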